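(* Let $n\ge1$ and let $\equiv$ be a catalan congruence of $\mathbf{ASM}_n$. Then: (a) each congruence class of $\equiv$ contains a unique minimal permutation, i.e. the set of $\sigma\in\mathfrak{S}_n$ whose matrix $P_\sigma$ lies in the class has exactly one minimal element (for the order of $\mathbf{ASM}_n$); (b) the minimal permutations of the congruence classes are precisely the $321$-avoiding permutations of $[n]$.
   Context: An alternating sign matrix (ASM) of order $n$ is an $n\times n$ matrix $A$ with entries in $\{-1,0,1\}$, all row and column sums $1$, and whose nonzero entries alternate in sign in each row and column. Its height function matrix (HFM) is $H_{i,j}=i+j-2\sum_{i'\le i,j'\le j}A_{i',j'}$, $0\le i,j\le n$. $\mathbf{ASM}_n$ is the set of ASMs of order $n$ ordered by entrywise comparison of HFMs; it is a distributive lattice. A permutation $\sigma\in\mathfrak{S}_n$ is identified with its permutation matrix $P_\sigma=[\delta_{\sigma(i),j}]_{i,j}\in\mathbf{ASM}_n$; the order of $\mathbf{ASM}_n$ restricts to the (strong) Bruhat order on $\mathfrak{S}_n$. $\mathbf{Dyck}_n$ (Stanley lattice) is the set of Dyck paths of semilength $n$ ordered by $P\le Q$ iff $P$ stays weakly below $Q$. A catalan congruence is a lattice congruence of $\mathbf{ASM}_n$ (an equivalence relation compatible with $\vee$ and $\wedge$) whose quotient lattice is isomorphic to $\mathbf{Dyck}_n$. *)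

(* Defs.v *)
From HB Require Import structures.
From mathcomp Require Import all_boot all_order all_fingroup all_algebra.
From mathcomp Require Import generic_quotient zify ring.

Set Implicit Arguments.
Unset Strict Implicit.
Unset Printing Implicit Defensive.

Import Order.TTheory GRing.Theory Num.Theory.
Local Open Scope ring_scope.

Definition lattice_iso (d1 d2 : Order.disp_t) (L1 : latticeType d1)
    (L2 : latticeType d2) : Prop :=
  exists f : L1 -> L2, [/\ bijective f,
    {morph f : x y / (x `&` y)%O >-> (x `&` y)%O} &
    {morph f : x y / (x `|` y)%O >-> (x `|` y)%O}].

Structure lattice_congruence (d : Order.disp_t) (L : latticeType d) :=
  LatticeCongruence {
    congruence_rel :> equiv_rel L;
    congruence_meet : forall x x' y y' : L,
      congruence_rel x x' -> congruence_rel y y' ->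
      congruence_rel (x `&` y)%O (x' `&` y')%O;
    congruence_join : forall x x' y y' : L,
      congruence_rel x x' -> congruence_rel y y' ->
      congruence_rel (x `|` y)%O (x' `|` y')%O }.

Definition lattice_quotient (d : Order.disp_t) (L : latticeType d)
  (e : lattice_congruence L) : Type := {eq_quot e}%qT.

Section LatticeQuotient.
Context (d : Order.disp_t) (L : latticeType d) (e : lattice_congruence L).
Local Open Scope quotient_scope.
Notation Q := (lattice_quotient e).
Implicit Types a b c : Q.

HB.instance Definition _ := Choice.on Q.
HB.instance Definition _ := EqQuotient.on Q.

Definition quotient_meet a b : Q := \pi_Q (repr a `&` repr b)%O.
Definition quotient_join a b : Q := \pi_Q (repr a `|` repr b)%O.
Definition quotient_le a b : bool := quotient_meet a b == a.

Lemma congruence_eqP (x y : L) : reflect (\pi_Q x = \pi_Q y) (e x y).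
Proof. by have := @eqmodP _ e x y. Qed.

Lemma congruence_repr (x : L) : e (repr (\pi_Q x)) x.
Proof. by apply/congruence_eqP; rewrite reprK. Qed.

Lemma quotient_meetE (x y : L) :
  quotient_meet (\pi_Q x) (\pi_Q y) = \pi_Q (x `&` y)%O.
Proof.
by apply/congruence_eqP/congruence_meet; apply: congruence_repr.
Qed.

Lemma quotient_joinE (x y : L) :
  quotient_join (\pi_Q x) (\pi_Q y) = \pi_Q (x `|` y)%O.
Proof.
by apply/congruence_eqP/congruence_join; apply: congruence_repr.
Qed.

Fact quotient_meetC : commutative quotient_meet.
Proof. by move=> a b; rewrite /quotient_meet meetC. Qed.

Fact quotient_joinC : commutative quotient_join.
Proof. by move=> a b; rewrite /quotient_join joinC. Qed.

Fact quotient_meetA : associative quotient_meet.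
Proof.
elim/quotW=> x; elim/quotW=> y; elim/quotW=> z.
rewrite (quotient_meetE x y) (quotient_meetE y z).
by rewrite (quotient_meetE x) (quotient_meetE _ z) meetA.
Qed.

Fact quotient_joinA : associative quotient_join.
Proof.
elim/quotW=> x; elim/quotW=> y; elim/quotW=> z.
rewrite (quotient_joinE x y) (quotient_joinE y z).
by rewrite (quotient_joinE x) (quotient_joinE _ z) joinA.
Qed.

Fact quotient_joinKI b a : quotient_meet a (quotient_join a b) = a.
Proof.
elim/quotW: a => x; elim/quotW: b => y.
by rewrite (quotient_joinE x y) (quotient_meetE x) joinKI.
Qed.

Fact quotient_meetKU b a : quotient_join a (quotient_meet a b) = a.
Proof.
elim/quotW: a => x; elim/quotW: b => y.
by rewrite (quotient_meetE x y) (quotient_joinE x) meetKU.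
Qed.

Fact quotient_le_refl : reflexive quotient_le.
Proof.
by elim/quotW=> x; rewrite /quotient_le (quotient_meetE x x) meetxx.
Qed.

Fact quotient_le_anti : antisymmetric quotient_le.
Proof. by move=> a b /andP[/eqP {2}<- /eqP {2}<-]; exact: quotient_meetC. Qed.

Fact quotient_le_trans : transitive quotient_le.
Proof.
move=> b a c /eqP ab /eqP bc.
by rewrite /quotient_le -ab -quotient_meetA bc ab.
Qed.

HB.instance Definition _ := Order.Le_isPOrder.Build d Q
  quotient_le_refl quotient_le_anti quotient_le_trans.

HB.instance Definition _ := Order.POrder_isLattice.Build d Q
  quotient_meetC quotient_joinC quotient_meetA quotient_joinA
  quotient_joinKI quotient_meetKU (fun _ _ => erefl).

End LatticeQuotient.

Definition alternating (s : seq int) : bool :=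
  sorted (fun x y => x * y < 0) [seq x <- s | x != 0].

Definition is_asm (n : nat) (A : 'M[int]_n) : bool :=
  [&& [forall i, forall j, A i j \in [:: -1; 0; 1]],
      [forall i, \sum_j A i j == 1],
      [forall j, \sum_i A i j == 1],
      [forall i, alternating [seq A i j | j : 'I_n]] &
      [forall j, alternating [seq A i j | i : 'I_n]]].

Record ASM (n : nat) := MkASM { asm_mx :> 'M[int]_n; _ : is_asm asm_mx }.

HB.instance Definition _ n := [isSub for @asm_mx n].
HB.instance Definition _ n := [Choice of ASM n by <:].

(* Rows and columns of a matrix are numbered from 0, so the i-th corner sum
   adds up the rows i' < i. *)
Definition corner_sum (n : nat) (A : 'M[int]_n) (i j : nat) : int :=
  \sum_(i' < n | (i' < i)%N) \sum_(j' < n | (j' < j)%N) A i' j'.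

Definition hfm (n : nat) (A : 'M[int]_n) : 'M[int]_n.+1 :=
  \matrix_(i < n.+1, j < n.+1) ((i + j)%:Z - 2 * corner_sum A i j).

Definition asm_le (n : nat) (A B : ASM n) : bool :=
  [forall i, forall j, hfm A i j <= hfm B i j].

(* ASMs are characterised by their corner sums, and the entrywise minimum
   (resp. maximum) of two height function matrices is the maximum (resp.
   minimum) of the corner sums: this is how meets and joins are built. *)

Section PartialSums.

Let alt : rel int := fun x y => x * y < 0.

Lemma partial_sums_path (s : seq int) (b : bool) :
  (forall k, exists c : bool, b%:Z + \sum_(x <- take k s) x = c%:Z) <->
  all (mem [:: -1; 0; 1]) s /\
  path alt (if b then 1 else -1) [seq x <- s | x != 0].
Proof.
elim: s b => [|x s IHs] b.
  by split=> // _ k; exists b; rewrite big_nil addr0.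
have step c : b%:Z + x = c%:Z ->
    (forall k, exists c' : bool, b%:Z + \sum_(y <- take k (x :: s)) y = c'%:Z)
    <-> (forall k, exists c' : bool, c%:Z + \sum_(y <- take k s) y = c'%:Z).
  move=> Hc; split=> H k.
    by have [c' Hc'] := H k.+1; exists c'; rewrite -Hc' /= big_cons addrA Hc.
  case: k => [|k]; first by exists b; rewrite take0 big_nil addr0.
  by have [c' Hc'] := H k; exists c'; rewrite -Hc' /= big_cons addrA Hc.
have [[c Hc]|noc] : (exists c : bool, b%:Z + x = c%:Z) \/
                  ~ (exists c : bool, b%:Z + x = c%:Z).
- case: (eqVneq (b%:Z + x) 0) => [->|n0]; first by left; exists false.
  case: (eqVneq (b%:Z + x) 1) => [->|n1]; first by left; exists true.
  by right=> -[[] E]; [case/eqP: n1 | case/eqP: n0].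
- rewrite (step c Hc) IHs.
  have -> : x = c%:Z - b%:Z by rewrite -Hc; ring.
  by case: b c {Hc step} => [] [].
- split=> [H|].
    by case: noc; have [c] := H 1%N; rewrite /= take0 big_seq1; exists c.
  move=> [/= /andP[x3 _] p]; case: noc; move: x3 p; rewrite !inE.
  by case/or3P=> /eqP->; case: b {step}; rewrite //= => _;
     [exists false | exists true | exists false | exists true].
Qed.

Definition asm_line (s : seq int) : Prop :=
  (forall k, exists c : bool, \sum_(x <- take k s) x = c%:Z) /\
  \sum_(x <- s) x = 1.

Lemma asm_lineP (s : seq int) :
  [/\ all (mem [:: -1; 0; 1]) s, \sum_(x <- s) x = 1 & alternating s] <->
  asm_line s.
Proof.
have H0 (b := false) : (forall k, exists c : bool, \sum_(x <- take k s) x = c%:Z)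
   <-> all (mem [:: -1; 0; 1]) s /\ path alt (-1) [seq x <- s | x != 0].
  rewrite -(partial_sums_path s false).
  by split=> H k; have [c] := H k; exists c; rewrite ?add0r // in p *.
rewrite /asm_line H0; split=> [[s3 s1 salt]|[[s3 p] s1]]; last first.
  by split=> //; apply: path_sorted p.
split=> //; split=> //; move: s3 s1 salt; rewrite /alternating.
elim: s {H0} => [|x s IHs] //= /andP[x3 s3]; rewrite big_cons.
move: x3; rewrite !inE => /or3P[] /eqP-> /=; rewrite ?add0r; last by [].
  move=> s1 p; have [_ H] := partial_sums_path s false.
  have [c] := H (conj s3 p) (size s).
  by rewrite take_size add0r => E; move: s1; rewrite E; case: c {E}.
exact: IHs.
Qed.

Lemma sum_ltS n (F : 'I_n -> int) (i : 'I_n) :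
  \sum_(j < n | (j < i.+1)%N) F j = \sum_(j < n | (j < i)%N) F j + F i.
Proof.
rewrite (bigD1 i) //= addrC; congr (_ + _); apply: eq_bigl => j.
by rewrite ltnS ltn_neqAle andbC.
Qed.

Lemma sum_lt_all n (F : 'I_n -> int) k : (n <= k)%N ->
  \sum_(j < n | (j < k)%N) F j = \sum_j F j.
Proof. by move=> nk; apply: eq_bigl => j; apply: leq_trans nk. Qed.

Lemma sum_lt_minn n (F : 'I_n -> int) k :
  \sum_(j < n | (j < k)%N) F j = \sum_(j < n | (j < minn k n)%N) F j.
Proof. by apply: eq_bigl => j; rewrite ltn_min ltn_ord andbT. Qed.

Lemma sum_take n (F : 'I_n -> int) k :
  \sum_(x <- take k [seq F j | j : 'I_n]) x = \sum_(j < n | (j < k)%N) F j.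
Proof.
have E m : (m <= n)%N ->
  \sum_(x <- take m [seq F j | j : 'I_n]) x = \sum_(j < n | (j < m)%N) F j.
  elim: m => [_|m IHm mn]; first by rewrite take0 big_nil big_pred0.
  rewrite (take_nth 0) ?size_image ?card_ord // big_rcons /= IHm ?(ltnW mn) //.
  rewrite (sum_ltS F (Ordinal mn)); congr (_ + _).
  rewrite (nth_map (Ordinal mn)) ?size_enum_ord //; congr F.
  by apply: val_inj; rewrite /= nth_enum_ord.
have [/E//|nk] := leqP k n.
rewrite take_oversize ?size_image ?card_ord ?(ltnW nk) // sum_lt_all ?(ltnW nk)//.
by rewrite big_image.
Qed.

Definition asm_row n (F : 'I_n -> int) : Prop :=
  (forall k : nat, (k <= n)%N ->
     exists c : bool, \sum_(j < n | (j < k)%N) F j = c%:Z) /\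
  \sum_j F j = 1.

Lemma asm_rowP n (F : 'I_n -> int) :
  [/\ forall j, F j \in [:: -1; 0; 1], \sum_j F j = 1
    & alternating [seq F j | j : 'I_n]] <-> asm_row F.
Proof.
have E : asm_line [seq F j | j : 'I_n] <-> asm_row F.
  rewrite /asm_line big_image; split=> -[H s1]; split=> // k.
    by move=> _; rewrite -sum_take.
  by rewrite sum_take sum_lt_minn; apply: H; apply: geq_minr.
rewrite -E -asm_lineP big_image; split=> -[H1 H2 H3]; split=> //.
  by apply/allP=> _ /imageP[j _ ->]; apply: H1.
by move=> j; have /allP := H1; apply; apply: image_f.
Qed.

End PartialSums.

Lemma is_asmP n (A : 'M[int]_n) :
  (forall i, asm_row (fun j => A i j)) /\ (forall j, asm_row (fun i => A i j)) <->
  is_asm A.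
Proof.
split=> [[HR HC]|/and5P[/forallP H1 /forallP H2 /forallP H3 /forallP H4
                         /forallP H5]].
  apply/and5P; split; apply/forallP=> i.
  - by have /asm_rowP[H _ _] := HR i; apply/forallP.
  - by have /asm_rowP[_ -> _] := HR i.
  - by have /asm_rowP[_ -> _] := HC i.
  - by have /asm_rowP[_ _ ->] := HR i.
  - by have /asm_rowP[_ _ ->] := HC i.
split=> i; apply/asm_rowP; split.
- by move=> j; have /forallP := H1 i.
- exact/eqP.
- exact: H4.
- by move=> j; have /forallP := H1 j.
- exact/eqP.
- exact: H5.
Qed.

Section CornerSums.
Variable n : nat.
Implicit Types (A B C : ASM n) (i j : nat).

Lemma corner_sum0r (A : 'M[int]_n) i : corner_sum A i 0 = 0.
Proof. by rewrite /corner_sum big1 // => i' _; rewrite big_pred0. Qed.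

Lemma corner_sum0l (A : 'M[int]_n) j : corner_sum A 0 j = 0.
Proof. by rewrite /corner_sum big_pred0. Qed.

Lemma corner_sumSl (A : 'M[int]_n) (i : 'I_n) j :
  corner_sum A i.+1 j = corner_sum A i j + \sum_(j' < n | (j' < j)%N) A i j'.
Proof. exact: sum_ltS. Qed.

Lemma corner_sumSr (A : 'M[int]_n) i (j : 'I_n) :
  corner_sum A i j.+1 = corner_sum A i j + \sum_(i' < n | (i' < i)%N) A i' j.
Proof.
by rewrite /corner_sum -big_split; apply: eq_bigr => i' _; apply: sum_ltS.
Qed.

Definition is_corner (c : nat -> nat -> int) : Prop :=
  [/\ forall k, (k <= n)%N -> c 0%N k = 0 /\ c k 0%N = 0,
      forall k, (k <= n)%N -> c n k = k%:Z /\ c k n = k%:Z,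
      forall i j, (i < n)%N -> (j <= n)%N ->
        c i.+1 j = c i j \/ c i.+1 j = c i j + 1
    & forall i j, (i <= n)%N -> (j < n)%N ->
        c i j.+1 = c i j \/ c i j.+1 = c i j + 1].

Lemma corner_sum_is_corner A : is_corner (corner_sum A).
Proof.
case: A => A /is_asmP[HR HC] /=; split=> [k _|k|i j lt_in le_jn|i j le_in lt_jn].
- by rewrite corner_sum0l corner_sum0r.
- elim: k => [_|k IHk lt_kn]; first by rewrite corner_sum0l corner_sum0r.
  have [IH1 IH2] := IHk (ltnW lt_kn); pose k' := Ordinal lt_kn.
  rewrite (corner_sumSl A k') (corner_sumSr A n k') /= IH1 IH2 !sum_lt_all //.
  by have [_ ->] := HR k'; have [_ ->] := HC k'; split; lia.
- rewrite (corner_sumSl A (Ordinal lt_in)).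
  by have [/(_ j le_jn)[[] ->] _] := HR (Ordinal lt_in); [right|left; rewrite addr0].
- rewrite (corner_sumSr A i (Ordinal lt_jn)).
  by have [/(_ i le_in)[[] ->] _] := HC (Ordinal lt_jn); [right|left; rewrite addr0].
Qed.

Definition mx_of_corner (c : nat -> nat -> int) : 'M[int]_n :=
  \matrix_(i, j) (c i.+1 j.+1 - c i j.+1 - c i.+1 j + c i j).

Section MxOfCorner.
Variables (c : nat -> nat -> int) (Hc : is_corner c).

Lemma mx_of_corner_row (i : 'I_n) k : (k <= n)%N ->
  \sum_(j < n | (j < k)%N) mx_of_corner c i j = c i.+1 k - c i k.
Proof.
have [H0 _ _ _] := Hc; elim: k => [_|k IHk lt_kn].
  by rewrite big_pred0 //; have [_ ->] := H0 i.+1 (ltn_ord i);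
     have [_ ->] := H0 i (ltnW (ltn_ord i)).
by rewrite (sum_ltS _ (Ordinal lt_kn)) /= IHk ?(ltnW lt_kn) // mxE /=; ring.
Qed.

Lemma mx_of_corner_col (j : 'I_n) k : (k <= n)%N ->
  \sum_(i < n | (i < k)%N) mx_of_corner c i j = c k j.+1 - c k j.
Proof.
have [H0 _ _ _] := Hc; elim: k => [_|k IHk lt_kn].
  by rewrite big_pred0 //; have [-> _] := H0 j.+1 (ltn_ord j);
     have [-> _] := H0 j (ltnW (ltn_ord j)).
by rewrite (sum_ltS _ (Ordinal lt_kn)) /= IHk ?(ltnW lt_kn) // mxE /=; ring.
Qed.

Lemma mx_of_corner_asm : is_asm (mx_of_corner c).
Proof.
have [_ H1 H2 H3] := Hc.
apply/is_asmP; split=> i; split=> [k le_kn|].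
- rewrite mx_of_corner_row //; have [->|->] := H2 i k (ltn_ord i) le_kn.
    by exists false; rewrite subrr.
  by exists true; rewrite addrAC subrr add0r.
- rewrite -(sum_lt_all _ (leqnn n)) mx_of_corner_row //.
  have [_ ->] := H1 i.+1 (ltn_ord i).
  by have [_ ->] := H1 i (ltnW (ltn_ord i)); lia.
- rewrite mx_of_corner_col //; have [->|->] := H3 k i le_kn (ltn_ord i).
    by exists false; rewrite subrr.
  by exists true; rewrite addrAC subrr add0r.
- rewrite -(sum_lt_all _ (leqnn n)) mx_of_corner_col //.
  have [-> _] := H1 i.+1 (ltn_ord i).
  by have [-> _] := H1 i (ltnW (ltn_ord i)); lia.
Qed.

Definition asm_of_corner : ASM n := MkASM mx_of_corner_asm.

Lemma asm_of_cornerE i j : (i <= n)%N -> (j <= n)%N ->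
  corner_sum asm_of_corner i j = c i j.
Proof.
have [H0 _ _ _] := Hc.
move=> + le_jn; elim: i => [_|i IHi lt_in].
  by rewrite corner_sum0l; have [-> _] := H0 j le_jn.
rewrite (corner_sumSl _ (Ordinal lt_in)) /= IHi ?(ltnW lt_in) //.
by rewrite mx_of_corner_row //=; ring.
Qed.

End MxOfCorner.

Lemma asm_leP A B :
  reflect (forall i j, (i <= n)%N -> (j <= n)%N ->
             corner_sum B i j <= corner_sum A i j) (asm_le A B).
Proof.
apply: (iffP forallP) => H.
  move=> i j le_in le_jn.
  have /forallP/(_ (Ordinal (le_jn : j < n.+1)%N)) :=
    H (Ordinal (le_in : i < n.+1)%N).
  by rewrite !mxE /=; lia.
move=> i; apply/forallP=> j.
by have := H i j (ltn_ord i) (ltn_ord j); rewrite !mxE /=; lia.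
Qed.

Lemma corner_sum_inj A B :
  (forall i j, (i <= n)%N -> (j <= n)%N -> corner_sum A i j = corner_sum B i j) ->
  A = B.
Proof.
move=> eqAB; apply/val_inj/matrixP=> i j /=.
have E (C : ASM n) : C i j = corner_sum C i.+1 j.+1 - corner_sum C i j.+1
                    - corner_sum C i.+1 j + corner_sum C i j.
  by rewrite !corner_sumSl sum_ltS; ring.
have [li lj] := (ltn_ord i, ltn_ord j).
by rewrite !E !eqAB // ltnW.
Qed.

Fact asm_le_refl : reflexive (@asm_le n).
Proof. by move=> A; apply/asm_leP. Qed.

Fact asm_le_anti : antisymmetric (@asm_le n).
Proof.
move=> A B /andP[/asm_leP AB /asm_leP BA]; apply: corner_sum_inj => i j li lj.
by apply/le_anti; rewrite AB ?BA.
Qed.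

Fact asm_le_trans : transitive (@asm_le n).
Proof.
move=> B A C /asm_leP AB /asm_leP BC; apply/asm_leP=> i j li lj.
by apply: le_trans (AB i j li lj); apply: BC.
Qed.

Fact corner_max A B :
  is_corner (fun i j => Num.max (corner_sum A i j) (corner_sum B i j)).
Proof.
have [A1 A2 A3 A4] := corner_sum_is_corner A.
have [B1 B2 B3 B4] := corner_sum_is_corner B.
split=> [k lk|k lk|i j li lj|i j li lj].
- by have [-> ->] := A1 k lk; have [-> ->] := B1 k lk.
- by have [-> ->] := A2 k lk; have [-> ->] := B2 k lk; rewrite maxxx.
- by have := A3 i j li lj; have := B3 i j li lj; lia.
- by have := A4 i j li lj; have := B4 i j li lj; lia.
Qed.

Fact corner_min A B :
  is_corner (fun i j => Num.min (corner_sum A i j) (corner_sum B i j)).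
Proof.
have [A1 A2 A3 A4] := corner_sum_is_corner A.
have [B1 B2 B3 B4] := corner_sum_is_corner B.
split=> [k lk|k lk|i j li lj|i j li lj].
- by have [-> ->] := A1 k lk; have [-> ->] := B1 k lk.
- by have [-> ->] := A2 k lk; have [-> ->] := B2 k lk; rewrite minxx.
- by have := A3 i j li lj; have := B3 i j li lj; lia.
- by have := A4 i j li lj; have := B4 i j li lj; lia.
Qed.

Definition asm_meet A B : ASM n := asm_of_corner (corner_max A B).
Definition asm_join A B : ASM n := asm_of_corner (corner_min A B).

Lemma corner_sum_meet A B i j : (i <= n)%N -> (j <= n)%N ->
  corner_sum (asm_meet A B) i j = Num.max (corner_sum A i j) (corner_sum B i j).
Proof. exact: asm_of_cornerE. Qed.

Lemma corner_sum_join A B i j : (i <= n)%N -> (j <= n)%N ->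
  corner_sum (asm_join A B) i j = Num.min (corner_sum A i j) (corner_sum B i j).
Proof. exact: asm_of_cornerE. Qed.

Fact asm_meetP A B C : asm_le A (asm_meet B C) = asm_le A B && asm_le A C.
Proof.
apply/asm_leP/andP => [H|[/asm_leP HB /asm_leP HC] i j li lj].
  split; apply/asm_leP=> i j li lj; have := H i j li lj;
  by rewrite corner_sum_meet // ge_max => /andP[].
by rewrite corner_sum_meet // ge_max HB ?HC.
Qed.

Fact asm_joinP A B C : asm_le (asm_join A B) C = asm_le A C && asm_le B C.
Proof.
apply/asm_leP/andP => [H|[/asm_leP HA /asm_leP HB] i j li lj].
  split; apply/asm_leP=> i j li lj; have := H i j li lj;
  by rewrite corner_sum_join // le_min => /andP[].
by rewrite corner_sum_join // le_min HA ?HB.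
Qed.

Fact asm_meetUl : left_distributive asm_meet asm_join.
Proof.
move=> A B C; apply: corner_sum_inj => i j li lj.
rewrite !(corner_sum_meet, corner_sum_join) //; lia.
Qed.

End CornerSums.

Fact asm_display : Order.disp_t. Proof. exact: Order.Disp tt tt. Qed.

HB.instance Definition _ n := Order.Le_isPOrder.Build asm_display (ASM n)
  (@asm_le_refl n) (@asm_le_anti n) (@asm_le_trans n).
HB.instance Definition _ n := Order.POrder_MeetJoin_isLattice.Build
  asm_display (ASM n) (@asm_meetP n) (@asm_joinP n).
HB.instance Definition _ n := Order.Lattice_Meet_isDistrLattice.Build
  asm_display (ASM n) (@asm_meetUl n).

Lemma hfm_meet n (A B : ASM n) i j :
  hfm (A `&` B)%O i j = Num.min (hfm A i j) (hfm B i j).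
Proof.
have [li lj] := (ltn_ord i, ltn_ord j).
by rewrite !mxE corner_sum_meet //; lia.
Qed.

Lemma hfm_join n (A B : ASM n) i j :
  hfm (A `|` B)%O i j = Num.max (hfm A i j) (hfm B i j).
Proof.
have [li lj] := (ltn_ord i, ltn_ord j).
by rewrite !mxE corner_sum_join //; lia.
Qed.

Lemma perm_mx_asm n (s : 'S_n) : is_asm (perm_mx s : 'M[int]_n).
Proof.
have rowP (F : 'I_n -> int) j0 : (forall j, F j = (j == j0)%:R) -> asm_row F.
  move=> FE; split=> [k _|]; last first.
    rewrite (bigD1 j0) //= FE eqxx big1 ?addr0 // => j /negbTE jj0.
    by rewrite FE jj0.
  exists (j0 < k)%N; case: ltnP => [lt_jk|le_kj].
    rewrite (bigD1 j0) //= FE eqxx big1 ?addr0 // => j /andP[_ /negbTE jj0].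
    by rewrite FE jj0.
  rewrite big1 // => j lt_jk; rewrite FE; case: eqP => // jj0.
  by move: lt_jk; rewrite jj0 ltnNge le_kj.
apply/is_asmP; split=> i.
  by apply: (rowP _ (s i)) => j; rewrite !mxE eq_sym.
apply: (rowP _ (s^-1 i)%g) => j; rewrite !mxE; congr (_%:R); congr nat_of_bool.
by apply/eqP/eqP => [<-|->]; rewrite ?permK ?permKV.
Qed.

(* perm_mx s is the matrix with entries (s i == j)%:R *)
Definition perm_asm (n : nat) (s : 'S_n) : ASM n := MkASM (perm_mx_asm s).

Definition avoids_321 (n : nat) (s : 'S_n) : Prop :=
  forall i j k : 'I_n, (i < j)%N -> (j < k)%N ->
    ~ ((s k < s j)%N /\ (s j < s i)%N).

(* A path is a sequence of steps: true is an up step, false a down step. *)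
Definition height (s : seq bool) (k : nat) : int :=
  \sum_(b <- take k s) (if b then 1 else -1).

Definition is_dyck (n : nat) (s : (n.*2).-tuple bool) : bool :=
  [forall k : 'I_(n.*2).+1, 0 <= height s k] && (height s n.*2 == 0).

Record dyck (n : nat) :=
  MkDyck { dyck_steps :> (n.*2).-tuple bool; _ : is_dyck dyck_steps }.

HB.instance Definition _ n := [isSub for @dyck_steps n].
HB.instance Definition _ n := [Finite of dyck n by <:].

Definition dyck_le (n : nat) (P Q : dyck n) : bool :=
  [forall k : 'I_(n.*2).+1, height P k <= height Q k].

Section DyckLattice.
Variable n : nat.
Implicit Types (P Q R : dyck n) (k : nat).

Lemma heightS (s : seq bool) k : (k < size s)%N ->
  height s k.+1 = height s k + (if nth false s k then 1 else -1).
Proof. by move=> lt_ks; rewrite /height (take_nth false) // big_rcons. Qed.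

Lemma height0 (s : seq bool) : height s 0 = 0.
Proof. by rewrite /height take0 big_nil. Qed.

Definition is_dyck_height (h : nat -> int) : Prop :=
  [/\ h 0%N = 0, h n.*2 = 0, forall k, (k <= n.*2)%N -> 0 <= h k
    & forall k, (k < n.*2)%N -> h k.+1 = h k + 1 \/ h k.+1 = h k - 1].

Lemma height_is_dyck_height P : is_dyck_height (height P).
Proof.
case: P => s /= /andP[/forallP H /eqP H0]; split=> // [|k lk|k lk].
- exact: height0.
- exact: H (Ordinal (lk : k < n.*2.+1)%N).
- by rewrite heightS ?size_tuple //; case: nth; [left|right].
Qed.

Definition steps_of_height (h : nat -> int) : (n.*2).-tuple bool :=
  [tuple h i < h i.+1 | i < n.*2].

Section OfHeight.
Variables (h : nat -> int) (Hh : is_dyck_height h).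

Lemma steps_of_heightE k : (k <= n.*2)%N -> height (steps_of_height h) k = h k.
Proof.
have [h0 _ _ hS] := Hh; elim: k => [_|k IHk lk]; first by rewrite height0 h0.
rewrite heightS ?size_tuple // IHk ?(ltnW lk) //.
have -> : nth false (steps_of_height h) k = (h k < h k.+1).
  by rewrite -[k]/(val (Ordinal lk)) -tnth_nth tnth_mktuple.
by have [->|->] := hS k lk; case: ltP; lia.
Qed.

Lemma steps_of_height_dyck : is_dyck (steps_of_height h).
Proof.
have [_ h2 hge _] := Hh.
rewrite /is_dyck steps_of_heightE // h2 eqxx andbT; apply/forallP=> k.
by rewrite steps_of_heightE ?hge // -ltnS.
Qed.

Definition dyck_of_height : dyck n := MkDyck steps_of_height_dyck.

Lemma dyck_of_heightE k : (k <= n.*2)%N -> height dyck_of_height k = h k.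
Proof. exact: steps_of_heightE. Qed.

End OfHeight.

Lemma height_inj P Q :
  (forall k, (k <= n.*2)%N -> height P k = height Q k) -> P = Q.
Proof.
move=> eqPQ; apply/val_inj/eq_from_tnth=> k /=; have lk := ltn_ord k.
have := eqPQ k.+1 lk; rewrite !heightS ?size_tuple // eqPQ ?(ltnW lk) //.
by rewrite !(tnth_nth false) /=; do 2![case: nth]; lia.
Qed.

Lemma dyck_leP P Q :
  reflect (forall k, (k <= n.*2)%N -> height P k <= height Q k) (dyck_le P Q).
Proof.
apply: (iffP forallP) => [H k lk|H k]; last by apply: H; rewrite -ltnS.
exact: H (Ordinal (lk : k < n.*2.+1)%N).
Qed.

Fact dyck_le_refl : reflexive (@dyck_le n).
Proof. by move=> P; apply/dyck_leP. Qed.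

Fact dyck_le_anti : antisymmetric (@dyck_le n).
Proof.
move=> P Q /andP[/dyck_leP PQ /dyck_leP QP]; apply: height_inj => k lk.
by apply/le_anti; rewrite PQ ?QP.
Qed.

Fact dyck_le_trans : transitive (@dyck_le n).
Proof.
move=> Q P R /dyck_leP PQ /dyck_leP QR; apply/dyck_leP=> k lk.
exact: le_trans (PQ k lk) (QR k lk).
Qed.

Lemma height_parity P Q k : (k <= n.*2)%N ->
  exists m : int, height P k = height Q k + 2 * m.
Proof.
elim: k => [_|k IHk lk]; first by exists 0; rewrite !height0.
have [m Hm] := IHk (ltnW lk); rewrite !heightS ?size_tuple // Hm.
by do 2![case: nth]; [exists m|exists (m + 1)|exists (m - 1)|exists m]; ring.
Qed.

Fact dyck_height_min P Q :
  is_dyck_height (fun k => Num.min (height P k) (height Q k)).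
Proof.
have [P1 P2 P3 P4] := height_is_dyck_height P.
have [Q1 Q2 Q3 Q4] := height_is_dyck_height Q.
split=> [||k lk|k lk]; rewrite ?P1 ?Q1 ?P2 ?Q2 ?minxx //.
  by rewrite le_min P3 ?Q3.
by have [m] := height_parity P Q (ltnW lk); have := P4 k lk; have := Q4 k lk; lia.
Qed.

Fact dyck_height_max P Q :
  is_dyck_height (fun k => Num.max (height P k) (height Q k)).
Proof.
have [P1 P2 P3 P4] := height_is_dyck_height P.
have [Q1 Q2 Q3 Q4] := height_is_dyck_height Q.
split=> [||k lk|k lk]; rewrite ?P1 ?Q1 ?P2 ?Q2 ?maxxx //.
  by rewrite le_max P3.
by have [m] := height_parity P Q (ltnW lk); have := P4 k lk; have := Q4 k lk; lia.
Qed.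

Definition dyck_meet P Q : dyck n := dyck_of_height (dyck_height_min P Q).
Definition dyck_join P Q : dyck n := dyck_of_height (dyck_height_max P Q).

Lemma height_meet P Q k : (k <= n.*2)%N ->
  height (dyck_meet P Q) k = Num.min (height P k) (height Q k).
Proof. exact: dyck_of_heightE. Qed.

Lemma height_join P Q k : (k <= n.*2)%N ->
  height (dyck_join P Q) k = Num.max (height P k) (height Q k).
Proof. exact: dyck_of_heightE. Qed.

Fact dyck_meetP P Q R : dyck_le P (dyck_meet Q R) = dyck_le P Q && dyck_le P R.
Proof.
apply/dyck_leP/andP => [H|[/dyck_leP HQ /dyck_leP HR] k lk].
  by split; apply/dyck_leP=> k lk; have := H k lk;
     rewrite height_meet // le_min => /andP[].
by rewrite height_meet // le_min HQ ?HR.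
Qed.

Fact dyck_joinP P Q R : dyck_le (dyck_join P Q) R = dyck_le P R && dyck_le Q R.
Proof.
apply/dyck_leP/andP => [H|[/dyck_leP HP /dyck_leP HQ] k lk].
  by split; apply/dyck_leP=> k lk; have := H k lk;
     rewrite height_join // ge_max => /andP[].
by rewrite height_join // ge_max HP ?HQ.
Qed.

Fact dyck_meetUl : left_distributive dyck_meet dyck_join.
Proof.
move=> P Q R; apply: height_inj => k lk.
rewrite !(height_meet, height_join) //; lia.
Qed.

End DyckLattice.

Fact dyck_display : Order.disp_t. Proof. exact: Order.Disp tt tt. Qed.

HB.instance Definition _ n := Order.Le_isPOrder.Build dyck_display (dyck n)
  (@dyck_le_refl n) (@dyck_le_anti n) (@dyck_le_trans n).
HB.instance Definition _ n := Order.POrder_MeetJoin_isLattice.Build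
  dyck_display (dyck n) (@dyck_meetP n) (@dyck_joinP n).
HB.instance Definition _ n := Order.Lattice_Meet_isDistrLattice.Build
  dyck_display (dyck n) (@dyck_meetUl n).

Definition catalan_congruence (n : nat) (e : lattice_congruence (ASM n)) : Prop :=
  lattice_iso (lattice_quotient e) (dyck n).

Definition in_class (n : nat) (e : lattice_congruence (ASM n))
    (C : lattice_quotient e) (s : 'S_n) : Prop :=
  (\pi_(lattice_quotient e) (perm_asm s))%qT = C.

Definition minimal_perm (n : nat) (e : lattice_congruence (ASM n))
    (C : lattice_quotient e) (s : 'S_n) : Prop :=
  in_class C s /\
  forall t : 'S_n, in_class C t -> (perm_asm t <= perm_asm s)%O -> t = s.

(* Main.v *)
Require Import Defs.
From mathcomp Require Import all_boot all_order all_fingroup all_algebra.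
From mathcomp Require Import generic_quotient zify.

Set Implicit Arguments.
Unset Strict Implicit.
Unset Printing Implicit Defensive.

Import Order.TTheory GRing.Theory Num.Theory.
Local Open Scope ring_scope.

(* A catalan congruence amounts to a surjective lattice morphism [F] from [ASM n]
   onto the Dyck paths.  For a box [(a, b)], [0 < a <= b < n], the ASMs whose
   Dyck path lies above the box form a prime filter, hence are given by a
   condition [corner_sum A i j <= k].  Comparing ranks, and up to reversing the
   Dyck paths, one finds [k = a.-1] and [i + j = a + b], and [i = x a b] changes
   by 0 or 1 when the box grows by one step.  Reading [x] along a Dyck path [P]
   therefore gives a lattice path from [(0, 0)] to [(n, n)] such that [F A = P]
   iff the corner sums of [A] along it are the numbers of down steps of [P].
   Every permutation of the class has its dots below the path exactly in the rows
   that the path crosses by a down step, and its dots above the path exactly in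
   the columns crossed by a down step.  So, with [p i] and [q j] the numbers of
   such rows and columns, its corner sums are at most [minn (minn i j) (p i + q j)].
   This bound is attained by a permutation of the class, and by exactly the
   321-avoiding ones. *)

(** * Corner sums and prime filters of alternating sign matrices *)

Section CornerBounds.
Variable n : nat.
Implicit Types (A : ASM n) (i j : nat).

Lemma corner_sum_rows A i i' j : (i <= i' <= n)%N -> (j <= n)%N ->
  corner_sum A i j <= corner_sum A i' j <= corner_sum A i j + (i' - i)%N%:Z.
Proof.
case/andP=> le_ii' + le_jn; have [_ _ step _] := corner_sum_is_corner A.
elim: i' le_ii' => [|i' IH] le_ii' lt_i'n.
  by have ->: i = 0%N; lia.
have [E|lt_ii'] := eqVneq i i'.+1; first by rewrite E; lia.
by have := IH ltac:(lia) ltac:(lia); case: (step i' j lt_i'n le_jn); lia.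
Qed.

Lemma corner_sum_cols A i j j' : (i <= n)%N -> (j <= j' <= n)%N ->
  corner_sum A i j <= corner_sum A i j' <= corner_sum A i j + (j' - j)%N%:Z.
Proof.
move=> le_in /andP[le_jj']; have [_ _ _ step] := corner_sum_is_corner A.
elim: j' le_jj' => [|j' IH] le_jj' lt_j'n.
  by have ->: j = 0%N; lia.
have [E|lt_jj'] := eqVneq j j'.+1; first by rewrite E; lia.
by have := IH ltac:(lia) ltac:(lia); case: (step i j' le_in lt_j'n); lia.
Qed.

Lemma corner_sum_bounds A i j : (i <= n)%N -> (j <= n)%N ->
  [/\ 0 <= corner_sum A i j, corner_sum A i j <= i%:Z, corner_sum A i j <= j%:Z
    & (i + j)%N%:Z <= n%:Z + corner_sum A i j].
Proof.
move=> le_in le_jn; have [c0 cn _ _] := corner_sum_is_corner A.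
have [r0 _] := c0 j le_jn; have [_ r1] := c0 i le_in; have [r2 _] := cn j le_jn.
have := @corner_sum_rows A 0 i j ltac:(lia) le_jn.
have := @corner_sum_rows A i n j ltac:(lia) le_jn.
have := @corner_sum_cols A i 0 j le_in ltac:(lia).
rewrite r0 r1 r2; split; lia.
Qed.

(** Truncated subtraction suffices: corner sums are nondecreasing in each coordinate, so only an
    increase of a coordinate can raise them. *)
Lemma corner_sum_lipschitz A i j i' j' :
  (i <= n)%N -> (j <= n)%N -> (i' <= n)%N -> (j' <= n)%N ->
  corner_sum A i' j' <= corner_sum A i j + (i' - i)%N%:Z + (j' - j)%N%:Z.
Proof.
move=> le_in le_jn le_i'n le_j'n.
have H1 : corner_sum A i' j' <= corner_sum A i j' + (i' - i)%N%:Z.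
  case: (leqP i i') => le_ii'.
    by have := @corner_sum_rows A i i' j' ltac:(lia) le_j'n; lia.
  by have := @corner_sum_rows A i' i j' ltac:(lia) le_j'n; lia.
have H2 : corner_sum A i j' <= corner_sum A i j + (j' - j)%N%:Z.
  case: (leqP j j') => le_jj'.
    by have := @corner_sum_cols A i j j' le_in ltac:(lia); lia.
  by have := @corner_sum_cols A i j' j le_in ltac:(lia); lia.
lia.
Qed.

Section Bigrassmannian.
Variables (i j : 'I_n.+1) (k : nat).

(* Truncation at [i + j - n], the least possible corner sum at [(i, j)], makes
   the definition total. *)
Definition bigrassmannian_corner (i' j' : nat) : int :=
  (minn (minn i' j') (maxn k (i + j - n) + (i' - i) + (j' - j)))%:Z.

Fact bigrassmannian_is_corner : is_corner n bigrassmannian_corner.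
Proof.
have [li lj] := (ltn_ord i, ltn_ord j); rewrite /bigrassmannian_corner.
split=> [m lm|m lm|i' j' li' lj'|i' j' li' lj']; lia.
Qed.

Definition bigrassmannian : ASM n := asm_of_corner bigrassmannian_is_corner.

Lemma bigrassmannianE i' j' : (i' <= n)%N -> (j' <= n)%N ->
  corner_sum bigrassmannian i' j' = bigrassmannian_corner i' j'.
Proof. exact: asm_of_cornerE. Qed.

(** The Lipschitz bound makes [bigrassmannian_corner] the largest corner sum function under this
    bound at [(i, j)], and the order of ASMs reverses corner sums. *)
Lemma bigrassmannian_le A :
  (bigrassmannian <= A)%O = (corner_sum A i j <= (maxn k (i + j - n))%:Z).
Proof.
have [li lj] := (ltn_ord i, ltn_ord j).
apply/asm_leP/idP => [/(_ i j li lj)|H i' j' li' lj'].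
  by rewrite bigrassmannianE // /bigrassmannian_corner; lia.
have [] := corner_sum_bounds A li' lj'.
have := @corner_sum_lipschitz A i j i' j' li lj li' lj'.
rewrite bigrassmannianE // /bigrassmannian_corner; lia.
Qed.

End Bigrassmannian.

Section PrimeFilter.
Variable T : pred (ASM n).
Hypothesis TI : forall A B, T (A `&` B)%O = T A && T B.
Hypothesis TU : forall A B, T (A `|` B)%O = T A || T B.

Lemma prime_filter_le A B : (A <= B)%O -> T A -> T B.
Proof. by move=> /meet_idPl <-; rewrite TI => /andP[]. Qed.

(** [A] is the join of the bigrassmannians [J u] that match its corner sum at [u]; primeness puts
    one of them in [T]. *)
Lemma prime_filter_bigrassmannian A : T A ->
  exists t : 'I_n.+1 * 'I_n.+1 * 'I_n.+1,
    T (bigrassmannian t.1.1 t.1.2 t.2) /\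
    (bigrassmannian t.1.1 t.1.2 t.2 <= A)%O.
Proof.
move=> TA; pose J (u : 'I_n.+1 * 'I_n.+1) :=
  bigrassmannian u.1 u.2 `|corner_sum A u.1 u.2|%N.
have cA (i j : 'I_n.+1) := corner_sum_bounds A (ltn_ord i) (ltn_ord j).
have J_le u : (J u <= A)%O.
  by rewrite bigrassmannian_le; have [] := cA u.1 u.2; lia.
have [B [BJ TB]] : exists B : ASM n,
    (forall u, u \in enum {: 'I_n.+1 * 'I_n.+1} -> (J u <= B)%O) /\
    (T B -> exists u, T (J u)).
  elim: (enum _) => [|u s [B [BJ TB]]].
    by exists (J (ord0, ord0)); split=> // TJ; exists (ord0, ord0).
  exists (J u `|` B)%O; split=> [v|]; last first.
    by rewrite TU => /orP[TJ|//]; exists u.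
  rewrite inE => /predU1P[->|/BJ Jv]; first exact: leUl.
  by apply: le_trans Jv _; apply: leUr.
have AB : (A <= B)%O.
  apply/asm_leP=> i j li lj.
  have /asm_leP/(_ i j li lj) := BJ (Ordinal (li : i < n.+1)%N, Ordinal (lj : j < n.+1)%N)
    ltac:(by rewrite mem_enum).
  have [] := corner_sum_bounds A li lj.
  rewrite bigrassmannianE // /bigrassmannian_corner /=; lia.
have [u TJ] := TB (prime_filter_le AB TA).
have lt_u : (`|corner_sum A u.1 u.2| < n.+1)%N.
  by have [] := cA u.1 u.2; have := ltn_ord u.1; lia.
by exists (u, Ordinal lt_u); split=> //; apply: J_le.
Qed.

(* In a finite distributive lattice a proper prime filter is generated by a
   join-irreducible element. *)
Lemma prime_filterP A B : T A -> ~~ T B ->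
  exists i j k : nat, [/\ (i <= n)%N, (j <= n)%N, (i + j <= n + k)%N,
    (k < minn i j)%N & forall C, T C = (corner_sum C i j <= k%:Z)].
Proof.
move=> TA nTB; pose tri := ('I_n.+1 * 'I_n.+1 * 'I_n.+1)%type.
pose J (t : tri) := bigrassmannian t.1.1 t.1.2 t.2.
(* [M] is the meet of [A] and all bigrassmannians in [T]. It lies in [T], hence above a
   bigrassmannian of [T], which is then below every element of [T]. *)
have [M [TM MJ]] : exists M : ASM n, T M /\
    forall t, t \in enum {: tri} -> T (J t) -> (M <= J t)%O.
  elim: (enum _) => [|t s [M [TM MJ]]]; first by exists A.
  exists (if T (J t) then J t `&` M else M)%O; split.
    by case: ifP => // TJ; rewrite TI TJ.
  move=> u; rewrite inE => /predU1P[->|us] TJ; first by rewrite TJ; apply: leIl.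
  apply: le_trans (MJ u us TJ); case: ifP => // _; exact: leIr.
have [[[i j] k] /= [TJ JM]] := prime_filter_bigrassmannian TM.
have TE C : T C = (corner_sum C i j <= (maxn k (i + j - n))%:Z).
  rewrite -bigrassmannian_le; apply/idP/idP => [TC|/prime_filter_le/(_ TJ)//].
  have [t [TJt JC]] := prime_filter_bigrassmannian TC.
  apply: le_trans JM (le_trans _ JC); apply: MJ => //; exact: mem_enum.
have [li lj] := (ltn_ord i, ltn_ord j).
(* The maximum gives [i + j <= n + k]; the failure of [T B] gives [k < minn i j]. *)
exists i, j, (maxn k (i + j - n)); split=> //; first lia.
by have [] := corner_sum_bounds B li lj; move: nTB; rewrite TE; lia.
Qed.

End PrimeFilter.
End CornerBounds.

(** * Boxes under Dyck paths *)

Section DyckBoxes.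
Variable n : nat.
Implicit Types (P Q : dyck n) (a b k : nat).

Definition downs (P : dyck n) (k : nat) : nat := count negb (take k P).

Lemma downs0 P : downs P 0 = 0%N.
Proof. by rewrite /downs take0. Qed.

Lemma downsS P k : (k < n.*2)%N ->
  downs P k.+1 = downs P k \/ downs P k.+1 = (downs P k).+1.
Proof.
move=> lk; rewrite /downs (take_nth false) ?size_tuple // -cats1 count_cat /=.
by case: nth; [left|right]; lia.
Qed.

Lemma height_downs P k : (k <= n.*2)%N ->
  height P k = k%:Z - 2 * (downs P k)%:Z.
Proof.
elim: k => [_|k IHk lk]; first by rewrite height0 downs0.
rewrite heightS ?size_tuple // IHk ?(ltnW lk) // /downs.
rewrite (take_nth false) ?size_tuple // -cats1 count_cat /=.
by case: nth => /=; lia.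
Qed.

Lemma downs_top P : downs P n.*2 = n.
Proof.
by have [_ h2 _ _] := height_is_dyck_height P; have := height_downs P (leqnn _); lia.
Qed.

Lemma downs_bounds P k : (k <= n.*2)%N ->
  [/\ (downs P k).*2 <= k, k <= n + downs P k & downs P k <= n]%N.
Proof.
move=> lk; have [_ _ hge _] := height_is_dyck_height P.
have H m : (k + m <= n.*2)%N -> (downs P k <= downs P (k + m) <= downs P k + m)%N.
  elim: m => [|m IH] lm; first by rewrite addn0; lia.
  by have := downsS P (ltac:(lia) : (k + m < n.*2)%N); rewrite addnS; have := IH; lia.
have := H (n.*2 - k)%N; rewrite subnKC // downs_top.
by have := hge k lk; rewrite height_downs //; split; lia.
Qed.

(** The box is the diamond whose top vertex has abscissa [a + b] and height [b - a + 2]. For [0 < a]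
    it is under [P] iff at most [a.-1] of the first [a + b] steps are down. *)
Definition has_box (P : dyck n) (a b : nat) : bool :=
  b%:Z + 2 <= a%:Z + height P (a + b).

Lemma has_boxI P Q a b : (a + b <= n.*2)%N ->
  has_box (P `&` Q)%O a b = has_box P a b && has_box Q a b.
Proof. by move=> lab; rewrite /has_box height_meet //; lia. Qed.

Lemma has_boxU P Q a b : (a + b <= n.*2)%N ->
  has_box (P `|` Q)%O a b = has_box P a b || has_box Q a b.
Proof. by move=> lab; rewrite /has_box height_join //; lia. Qed.

Lemma height_lipschitz P k k' : (k <= n.*2)%N -> (k' <= n.*2)%N ->
  height P k' <= height P k + (k' - k)%N%:Z + (k - k')%N%:Z.
Proof.
have [_ _ _ step] := height_is_dyck_height P.
have H m l : (l + m <= n.*2)%N -> height P l <= height P (l + m) + m%:Z /\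
                                 height P (l + m) <= height P l + m%:Z.
  elim: m => [|m IH] lm; first by rewrite addn0; lia.
  by have := step (l + m)%N ltac:(lia); rewrite addnS; have := IH ltac:(lia); lia.
move=> lk lk'; case: (leqP k k') => kk'.
  by have := H (k' - k)%N k; rewrite subnKC // => /(_ lk'); lia.
by have := H (k - k')%N k'; rewrite subnKC ?(ltnW kk') // => /(_ lk); lia.
Qed.

Lemma has_box_sub P a b a' b' : (a' <= a)%N -> (b <= b')%N ->
  (a + b <= n.*2)%N -> (a' + b' <= n.*2)%N -> has_box P a' b' -> has_box P a b.
Proof.
move=> aa' bb' lab lab'; rewrite /has_box.
by have := height_lipschitz P lab' lab; have := height_lipschitz P lab lab'; lia.
Qed.

(** The witness is a pyramid with apex at the top of the box, resting on the zigzag path; for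
    [a = b.+1] only the zigzag is left, which has no box. *)
Lemma has_box_witness a b : (0 < a <= b.+1)%N -> (b < n)%N ->
  exists P, forall a' b', (0 < a' <= b')%N -> (b' < n)%N ->
    has_box P a' b' = (a <= a')%N && (b' <= b)%N.
Proof.
move=> ab lb; pose h k : int :=
  Num.max (odd k)%:Z (b%:Z + 2 - a%:Z - `|k%:Z - (a + b)%N%:Z|).
have Hh : is_dyck_height n h.
  split=> [||k lk|k lk]; rewrite /h /=; try by lia.
exists (dyck_of_height Hh) => a' b' ab' lb'.
rewrite /has_box dyck_of_heightE; last lia.
rewrite /h; lia.
Qed.

Fact dyck_rev_height P : is_dyck_height n (fun k => height P (n.*2 - k)).
Proof.
have [h0 h2 hge step] := height_is_dyck_height P.
split=> [||k lk|k lk]; rewrite ?subn0 ?subnn //; first by apply: hge; lia.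
have := step (n.*2 - k.+1)%N ltac:(lia).
by rewrite -subSn // subSS; lia.
Qed.

Definition dyck_rev P : dyck n := dyck_of_height (dyck_rev_height P).

Lemma height_dyck_rev P k : (k <= n.*2)%N ->
  height (dyck_rev P) k = height P (n.*2 - k).
Proof. exact: dyck_of_heightE. Qed.

Lemma dyck_revK : involutive dyck_rev.
Proof.
move=> P; apply: height_inj => k lk; rewrite !height_dyck_rev ?leq_subr //.
by rewrite subKn.
Qed.

Lemma has_box_rev P a b : (a <= n)%N -> (b <= n)%N ->
  has_box (dyck_rev P) a b = has_box P (n - b) (n - a).
Proof.
move=> la lb; rewrite /has_box height_dyck_rev; last lia.
have -> : (n.*2 - (a + b) = n - b + (n - a))%N by lia.
lia.
Qed.

End DyckBoxes.

(** * Generators of the prime filters of boxes *)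

Lemma finite_choice (T : Type) (t0 : T) (N : nat) (P : nat -> T -> Prop) :
  (forall a, (a < N)%N -> exists t, P a t) ->
  exists f : nat -> T, forall a, (a < N)%N -> P a (f a).
Proof.
elim: N => [|N IH] H; first by exists (fun=> t0).
have [|f Hf] := IH; first by move=> a lt_aN; apply: H; lia.
have [t Ht] := H N (leqnn _).
exists (fun a => if a == N then t else f a) => a lt_aN.
by case: eqP => [->//|neq]; apply: Hf; lia.
Qed.

(** Injectivity forbids turning back, so the walk is monotone, and its range fixes both ends. *)
Lemma unit_step_injection (n : nat) (p : nat -> nat) :
  (forall m, (0 < m < n)%N -> (0 < p m < n)%N) ->
  (forall m m', (0 < m < n)%N -> (0 < m' < n)%N -> p m = p m' -> m = m') ->
  (forall m, (0 < m)%N -> (m.+1 < n)%N -> p m.+1 = (p m).+1 \/ p m = (p m.+1).+1) ->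
  (forall m, (0 < m < n)%N -> p m = m) \/ (forall m, (0 < m < n)%N -> p m = (n - m)%N).
Proof.
move=> range inj step.
have noturn m : (0 < m)%N -> (m.+2 < n)%N -> p m.+2 <> p m.
  by move=> m0 mn E; have := inj m.+2 m ltac:(lia) ltac:(lia) E; lia.
have [n2|n2] := leqP n 2.
  by left=> m mn; have := range m mn; lia.
have := range 1%N ltac:(lia); have last_range := range n.-1 ltac:(lia).
case: (step 1%N isT n2) => p2 p1; [left|right].
  have up m : (m.+2 < n)%N -> p m.+2 = (p m.+1).+1.
    elim: m => [//|m IH] mn; have := step m.+2 isT mn.
    by have := noturn m.+1 isT mn; have := IH ltac:(lia); lia.
  have E m : (m.+1 < n)%N -> p m.+1 = (p 1 + m)%N.
    by elim: m => [|m IH] mn; [lia | rewrite up // IH; lia].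
  have := E n.-2 ltac:(lia); have -> : n.-2.+1 = n.-1 by lia.
  by move=> pn m mn; have := E m.-1 ltac:(lia); have -> : m.-1.+1 = m; lia.
have down m : (m.+2 < n)%N -> (p m.+2).+1 = p m.+1.
  elim: m => [//|m IH] mn; have := step m.+2 isT mn.
  by have := noturn m.+1 isT mn; have := IH ltac:(lia); lia.
have E m : (m.+1 < n)%N -> (p m.+1 + m = p 1)%N.
  elim: m => [|m IH] mn; first lia.
  by have := down m mn; have := IH ltac:(lia); lia.
have := E n.-2 ltac:(lia); have -> : n.-2.+1 = n.-1 by lia.
by move=> pn m mn; have := E m.-1 ltac:(lia); have -> : m.-1.+1 = m; lia.
Qed.

Section BoxGenerators.
Variables (n : nat) (F : ASM n -> dyck n).
Hypothesis F_surj : forall P, exists A, F A = P.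

Definition generates (a b i j k : nat) : Prop :=
  [/\ (i <= n)%N, (j <= n)%N, (i + j <= n + k)%N, (k < minn i j)%N &
      forall A, has_box (F A) a b = (corner_sum A i j <= k%:Z)].

Lemma box_generator (a b : nat) :
  {morph F : A B / (A `&` B)%O} -> {morph F : A B / (A `|` B)%O} ->
  (0 < a <= b)%N -> (b < n)%N -> exists i j k, generates a b i j k.
Proof.
move=> FI FU ab lb.
have [P HP] := @has_box_witness n a b ltac:(lia) lb.
(* With [(1, 0)] the witness is the zigzag path, which makes the filter proper. *)
have [Q HQ] := @has_box_witness n 1 0 isT ltac:(lia).
have [A FA] := F_surj P; have [B FB] := F_surj Q.
have TI C D : has_box (F (C `&` D)%O) a b = has_box (F C) a b && has_box (F D) a b.
  by rewrite FI has_boxI //; lia.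
have TU C D : has_box (F (C `|` D)%O) a b = has_box (F C) a b || has_box (F D) a b.
  by rewrite FU has_boxU //; lia.
have := prime_filterP TI TU (A := A) (B := B).
rewrite FA FB HP // HQ // !leqnn.
have /negbTE-> : ~~ ((1 <= a) && (b <= 0))%N by lia.
exact.
Qed.

Section Generators.
Variables gi gj gk : nat -> nat -> nat.
Hypothesis gen : forall a b, (0 < a <= b)%N -> (b < n)%N ->
  generates a b (gi a b) (gj a b) (gk a b).

(** The bigrassmannian generating the filter of the higher box also has the lower box; the bound
    comes from its corner sum at the position of the lower box. *)
Lemma generator_le (a b a' b' : nat) :
  (0 < a' <= a)%N -> (a <= b)%N -> (b <= b')%N -> (b' < n)%N ->
  (gk a' b' + (gi a b - gi a' b') + (gj a b - gj a' b') <= gk a b)%N.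
Proof.
move=> aa' ab bb' lb'.
have [li lj lk ltk H] := gen (ltac:(lia) : (0 < a <= b)%N) ltac:(lia).
have [li' lj' lk' ltk' H'] := gen (ltac:(lia) : (0 < a' <= b')%N) lb'.
pose i' := Ordinal (li' : (gi a' b' < n.+1)%N).
pose j' := Ordinal (lj' : (gj a' b' < n.+1)%N).
pose J := bigrassmannian i' j' (gk a' b').
have Jbox : has_box (F J) a' b'.
  have : (J <= J)%O by [].
  by rewrite bigrassmannian_le H' /=; lia.
have : has_box (F J) a b by apply: has_box_sub Jbox; lia.
by rewrite H bigrassmannianE // /bigrassmannian_corner /=; lia.
Qed.

Lemma generator_inj (a b a' b' : nat) :
  (0 < a <= b)%N -> (b < n)%N -> (0 < a' <= b')%N -> (b' < n)%N ->
  gi a b = gi a' b' -> gj a b = gj a' b' -> gk a b = gk a' b' -> a = a' /\ b = b'.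
Proof.
move=> ab lb ab' lb' ei ej ek.
have [_ _ _ _ H] := gen ab lb; have [_ _ _ _ H'] := gen ab' lb'.
have E (P : dyck n) : has_box P a b = has_box P a' b'.
  by have [A <-] := F_surj P; rewrite H H' ei ej ek.
have [P HP] := @has_box_witness n a b ltac:(lia) lb.
have [Q HQ] := @has_box_witness n a' b' ltac:(lia) lb'.
have := E P; have := E Q; rewrite !HP // !HQ //; lia.
Qed.

(** Up to a constant, [i + j - 2k] is the rank of the bigrassmannian [(i, j, k)]. It grows weakly by
    [generator_le], and strictly by injectivity. *)
Lemma generator_rank_lt (a b a' b' : nat) :
  (0 < a' <= a)%N -> (a <= b)%N -> (b <= b')%N -> (b' < n)%N ->
  (b - a < b' - a')%N ->
  (gi a b + gj a b + (gk a' b').*2 < gi a' b' + gj a' b' + (gk a b).*2)%N.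
Proof.
move=> aa' ab bb' lb' lt_rank.
have := generator_le aa' ab bb' lb'.
have : ~ (gi a b = gi a' b' /\ gj a b = gj a' b' /\ gk a b = gk a' b').
  move=> [ei [ej ek]].
  have := @generator_inj a b a' b' ltac:(lia) ltac:(lia) ltac:(lia) lb' ei ej ek.
  lia.
lia.
Qed.

(* A maximal chain of boxes has [n.-1] elements, as many as a longest chain of
   join-irreducibles of [ASM n]; so ranks are preserved. *)
Lemma generator_rank (a b : nat) : (0 < a <= b)%N -> (b < n)%N ->
  (gi a b + gj a b + a = (gk a b).*2 + b + 2)%N.
Proof.
move=> ab lb.
(* Climb from the diagonal box [(c, c)], of rank at least 2 since [k < minn i j]. *)
have lower m c : (0 < c)%N -> (c + m < n)%N ->
    ((gk c (c + m)).*2 + m + 2 <= gi c (c + m) + gj c (c + m))%N.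
  elim: m => [|m IH] c0 cn.
    rewrite !addn0; have [? ? ? ? _] := gen (ltac:(lia) : (0 < c <= c)%N) ltac:(lia); lia.
  have := IH c0 ltac:(lia).
  have := @generator_rank_lt c (c + m)%N c (c + m.+1)%N
    ltac:(lia) ltac:(lia) ltac:(lia) cn.
  by move=> /(_ ltac:(lia)); lia.
(* Descend from the top box [(1, n - 1)], of rank at most [n] since [i + j <= n + k], first to
   [(1, b)], then to [(a, b)]. *)
have upper1 m : (m.+1 < n)%N ->
    (gi 1 (n - m.+1) + gj 1 (n - m.+1) + m <= (gk 1 (n - m.+1)).*2 + n)%N.
  elim: m => [|m IH] mn.
    have [? ? ? ? _] := @gen 1 (n - 1)%N ltac:(lia) ltac:(lia); lia.
  have := IH ltac:(lia).
  have := @generator_rank_lt 1 (n - m.+2)%N 1 (n - m.+1)%N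
    ltac:(lia) ltac:(lia) ltac:(lia).
  by move=> /(_ ltac:(lia) ltac:(lia)); lia.
have upper m : (m.+1 <= b)%N ->
    (gi m.+1 b + gj m.+1 b + m <= (gk m.+1 b).*2 + b + 1)%N.
  elim: m => [|m IH] mb.
    have := upper1 (n - b.+1)%N ltac:(lia); have -> : (n - (n - b.+1).+1 = b)%N by lia.
    lia.
  have := IH ltac:(lia).
  have := @generator_rank_lt m.+2 b m.+1 b ltac:(lia) ltac:(lia) ltac:(lia) lb.
  by move=> /(_ ltac:(lia)); lia.
have := upper a.-1 ltac:(lia); have -> : a.-1.+1 = a by lia.
have := lower (b - a)%N a ltac:(lia); have -> : (a + (b - a) = b)%N by lia.
by move=> /(_ lb); lia.
Qed.

Lemma generator_diag (m : nat) : (0 < m < n)%N ->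
  gj m m = gi m m /\ (gk m m).+1 = gi m m.
Proof.
move=> mn; have := @generator_rank m m ltac:(lia) ltac:(lia).
by have [? ? ? ? _] := @gen m m ltac:(lia) ltac:(lia); lia.
Qed.

(** The boxes [(m, m)] and [(m.+1, m.+1)] lie below [(m, m.+1)], whose rank is only one more; so
    their positions are one step apart. *)
Lemma generator_orientation :
  (forall m, (0 < m < n)%N -> gi m m = m) \/
  (forall m, (0 < m < n)%N -> gi m m = (n - m)%N).
Proof.
apply: (@unit_step_injection n (fun m => gi m m)) => [m mn|m m' mn mn' E|m m0 mn].
- have [? ? ? ? _] := @gen m m ltac:(lia) ltac:(lia).
  by have := generator_diag mn; lia.
- have [d1 d2] := generator_diag mn; have [d1' d2'] := generator_diag mn'.
  by have [] := @generator_inj m m m' m' ltac:(lia) ltac:(lia) ltac:(lia) ltac:(lia)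
    E ltac:(lia) ltac:(lia).
have [d1 d2] := @generator_diag m ltac:(lia).
have [d1' d2'] := @generator_diag m.+1 ltac:(lia).
have rk := @generator_rank m m.+1 ltac:(lia) mn.
have := @generator_le m m m m.+1 ltac:(lia) ltac:(lia) ltac:(lia) mn.
have := @generator_le m.+1 m.+1 m m.+1 ltac:(lia) ltac:(lia) ltac:(lia) mn.
have := @generator_inj m m m.+1 m.+1 ltac:(lia) ltac:(lia) ltac:(lia) mn.
rewrite d1 d1' => neq.
have : gi m m <> gi m.+1 m.+1 by move=> E; have := neq E E ltac:(lia); lia.
lia.
Qed.

(** Comparison with the box [(a, a)] gives [k <= a.-1]; comparison with [(b, b)], together with the
    rank, gives [a.-1 <= k]. *)
Lemma generator_straight (a b : nat) :
  (forall m, (0 < m < n)%N -> gi m m = m) -> (0 < a <= b)%N -> (b < n)%N ->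
  gk a b = a.-1 /\ (gi a b + gj a b = a + b)%N.
Proof.
move=> straight ab lb.
have [da1 da2] := @generator_diag a ltac:(lia).
have [db1 db2] := @generator_diag b ltac:(lia).
have := generator_rank ab lb.
have := @generator_le a a a b ltac:(lia) ltac:(lia) ltac:(lia) lb.
have := @generator_le b b a b ltac:(lia) ltac:(lia) ltac:(lia) lb.
rewrite da1 db1 (straight a) ?(straight b) in da2 db2 *; lia.
Qed.

End Generators.
End BoxGenerators.

Definition coherent (n : nat) (x : nat -> nat -> nat) : Prop :=
  forall a b, (0 < a <= b)%N -> (b < n)%N ->
  [/\ (a <= x a b <= b)%N,
      (b.+1 < n)%N -> (x a b <= x a b.+1 <= (x a b).+1)%N &
      (a < b)%N -> (x a b <= x a.+1 b <= (x a b).+1)%N].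

Definition box_positions (n : nat) (F : ASM n -> dyck n) (x : nat -> nat -> nat) : Prop :=
  forall a b, (0 < a <= b)%N -> (b < n)%N -> forall A,
    has_box (F A) a b = (corner_sum A (x a b) (a + b - x a b) <= a.-1%:Z).

Lemma straight_box_positions (n : nat) (F : ASM n -> dyck n)
    (gi gj gk : nat -> nat -> nat) :
  (forall P, exists A, F A = P) ->
  (forall a b, (0 < a <= b)%N -> (b < n)%N ->
     generates F a b (gi a b) (gj a b) (gk a b)) ->
  (forall m, (0 < m < n)%N -> gi m m = m) ->
  coherent n gi /\ box_positions F gi.
Proof.
move=> F_surj gen straight.
have E a b ab lb := @generator_straight n F F_surj gi gj gk gen a b straight ab lb.
split=> a b ab lb; have [Ek Es] := E a b ab lb; last first.
  move=> A; have [_ _ _ _ ->] := gen a b ab lb.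
  by rewrite Ek -Es addKn.
split=> [|lb'|ab'].
- by have [? ? ? ? _] := gen a b ab lb; lia.
- have [Ek' Es'] := E a b.+1 ltac:(lia) lb'.
  have := generator_le gen (ltac:(lia) : (0 < a <= a)%N) (ltac:(lia) : (a <= b)%N)
    (leqnSn b) lb'; lia.
have [Ek' Es'] := E a.+1 b ltac:(lia) lb.
have := generator_le gen (ltac:(lia) : (0 < a <= a.+1)%N) ab' (leqnn b) lb; lia.
Qed.

Lemma ex_box_positions (n : nat) (F : ASM n -> dyck n) :
  {morph F : A B / (A `&` B)%O} -> {morph F : A B / (A `|` B)%O} ->
  (forall P, exists A, F A = P) ->
  exists x, coherent n x /\ (box_positions F x \/ box_positions (@dyck_rev n \o F) x).
Proof.
move=> FI FU F_surj.
have [g gen] : exists g : nat -> nat -> nat * nat * nat, forall a, (a < n)%N ->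
    forall b, (b < n)%N -> (0 < a <= b)%N ->
    generates F a b (g a b).1.1 (g a b).1.2 (g a b).2.
  apply: (@finite_choice _ (fun=> (0, 0, 0)%N) n (fun a h => forall b, (b < n)%N ->
    (0 < a <= b)%N -> generates F a b (h b).1.1 (h b).1.2 (h b).2)) => a la.
  apply: (@finite_choice _ (0, 0, 0)%N n (fun b t => (0 < a <= b)%N ->
    generates F a b t.1.1 t.1.2 t.2)) => b lb.
  have [ab|nab] := boolP (0 < a <= b)%N; last by exists (0, 0, 0)%N.
  have [i [j [k H]]] := box_generator F_surj FI FU ab lb.
  by exists (i, j, k).
pose gi a b := (g a b).1.1; pose gj a b := (g a b).1.2; pose gk a b := (g a b).2.
have {}gen a b : (0 < a <= b)%N -> (b < n)%N ->
    generates F a b (gi a b) (gj a b) (gk a b).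
  by move=> ab lb; apply: gen => //; lia.
have [straight|reversed] := generator_orientation F_surj gen.
  by exists gi; have [] := straight_box_positions F_surj gen straight; split=> //; left.
(* Reversing Dyck paths exchanges the boxes [(a, b)] and [(n - b, n - a)], hence the two
   orientations. *)
pose rev_arg (h : nat -> nat -> nat) a b := h (n - b)%N (n - a)%N.
have F'_surj P : exists A, (@dyck_rev n \o F) A = P.
  by have [A E] := F_surj (dyck_rev P); exists A; rewrite /= E dyck_revK.
exists (rev_arg gi).
have [||Hx HF] := @straight_box_positions n (@dyck_rev n \o F)
  (rev_arg gi) (rev_arg gj) (rev_arg gk) F'_surj; last by split=> //; right.
  move=> a b ab lb.
  have [H1 H2 H3 H4 H5] := gen (n - b)%N (n - a)%N ltac:(lia) ltac:(lia).
  by split=> // A; rewrite /= has_box_rev ?H5 //; lia.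
by move=> m mn; rewrite /rev_arg reversed; lia.
Qed.

(** * Corner sums of permutations *)

Section PermutationCorners.
Variable n : nat.
Implicit Types (t : 'S_n) (i j : nat).

Lemma corner_permE t i j :
  corner_sum (perm_asm t) i j = (\sum_(r < n | (r < i)%N) (t r < j)%N)%N%:Z.
Proof.
rewrite /corner_sum -natz natr_sum; apply: eq_bigr => r _.
rewrite big_mkcond (bigD1 (t r)) //= big1 => [|k /negbTE nk].
  by rewrite !mxE eqxx addr0; case: ifP.
by rewrite !mxE eq_sym nk; case: ifP.
Qed.

Lemma corner_perm_row t (r : 'I_n) j :
  corner_sum (perm_asm t) r.+1 j = corner_sum (perm_asm t) r j + (t r < j)%N%:Z.
Proof.
rewrite !corner_permE (bigD1 r) //= PoszD addrC; congr (_%:Z + _).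
by apply: eq_bigl => r'; rewrite ltnS ltn_neqAle andbC.
Qed.

Lemma corner_perm_inv t i j :
  corner_sum (perm_asm t^-1%g) j i = corner_sum (perm_asm t) i j.
Proof.
rewrite !corner_permE; congr Posz.
rewrite big_mkcond (reindex_inj (@perm_inj _ t)) [RHS]big_mkcond /=.
by apply: eq_bigr => r _; rewrite permK; do 2!case: (_ < _)%N.
Qed.

Lemma corner_perm_lt_row t i j : (i <= n)%N ->
  corner_sum (perm_asm t) i j < i%:Z -> exists2 r : 'I_n, (r < i)%N & (j <= t r)%N.
Proof.
elim: i => [|i IH] le_in; first by rewrite corner_sum0l.
rewrite (corner_perm_row t (Ordinal le_in)) [nat_of_ord (Ordinal _)]/=.
case: ltnP => [lt_j|le_j] lt_c.
  by have [|r ri jr] := IH (ltnW le_in); [lia | exists r; rewrite // ltnW].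
by exists (Ordinal le_in).
Qed.

Lemma corner_perm_lt_col t i j : (j <= n)%N ->
  corner_sum (perm_asm t) i j < j%:Z ->
  exists2 r : 'I_n, (i <= r)%N & (t r < j)%N.
Proof.
rewrite -corner_perm_inv => jn /(corner_perm_lt_row jn)[k kj ik].
by exists (t^-1 k)%g; rewrite ?permKV.
Qed.

Lemma perm_asm_inj : injective (@perm_asm n).
Proof.
move=> s t /(congr1 (@asm_mx n)) /matrixP E; apply/permP => r.
by have := E r (s r); rewrite !mxE eqxx; case: eqP.
Qed.

Lemma nonneg_asm_perm (A : ASM n) : (forall i j : 'I_n, 0 <= A i j) ->
  exists t : 'S_n, A = perm_asm t.
Proof.
move=> A_ge0; have /and5P[_ /forallP rows1 /forallP cols1 _ _] := valP A.
have rows (i : 'I_n) : \sum_j A i j = 1 by apply/eqP/rows1.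
have cols (j : 'I_n) : \sum_i A i j = 1 by apply/eqP/cols1.
have A01 (i j : 'I_n) : A i j = 0 \/ 1 <= A i j by have := A_ge0 i j; lia.
have [f Hf] : exists f : 'I_n -> 'I_n, forall i : 'I_n, 1 <= A i (f i).
  apply: (@fin_all_exists _ _ (fun i j : 'I_n => 1 <= A i j)) => i.
  have [/existsP[j Hj]|/existsPn none] := boolP [exists j : 'I_n, 1 <= A i j].
    by exists j.
  have := rows i; rewrite big1 // => j _.
  by have := none j; case: (A01 i j) => // ->.
have rest (i j : 'I_n) : j != f i -> A i j = 0.
  move=> nj; have := rows i; rewrite (bigD1 (f i)) //= (bigD1 j) //=.
  set S := \sum_(_ | _) _; have : 0 <= S by apply: sumr_ge0.
  by have := Hf i; have := A_ge0 i j; lia.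
have f_inj : injective f.
  move=> i i' E; apply/eqP; apply: contraT => ni.
  have := cols (f i); rewrite (bigD1 i) //= (bigD1 i') ?(eq_sym i') //=.
  set S := \sum_(_ | _) _; have : 0 <= S by apply: sumr_ge0.
  by have := Hf i; have := Hf i'; rewrite -E; lia.
exists (perm f_inj); apply/val_inj/matrixP => i j.
rewrite !mxE permE /=; case: eqP => [<-|/eqP nj]; last by rewrite rest // eq_sym.
have := rows i; rewrite (bigD1 (f i)) //= big1 ?addr0 // => k nk.
exact: rest.
Qed.

Lemma avoids_321_inv t : avoids_321 t -> avoids_321 t^-1%g.
Proof.
move=> av i j k ij jk [kj ji].
by apply: (av (t^-1 k) (t^-1 j) (t^-1 i))%g; rewrite ?permKV.
Qed.

End PermutationCorners.

(** * Labelled lattice paths *)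

Record lattice_path (n : nat) := LatticePath {
  path_row : nat -> nat;
  path_col : nat -> nat;
  path_label : nat -> nat;
  path_start : [/\ path_row 0 = 0, path_col 0 = 0 & path_label 0 = 0]%N;
  path_end : [/\ path_row n.*2 = n, path_col n.*2 = n & path_label n.*2 = n];
  path_step : forall s, (s < n.*2)%N ->
    path_row s.+1 = (path_row s).+1 /\ path_col s.+1 = path_col s \/
    path_row s.+1 = path_row s /\ path_col s.+1 = (path_col s).+1;
  label_step : forall s, (s < n.*2)%N ->
    path_label s.+1 = path_label s \/ path_label s.+1 = (path_label s).+1 }.

(** Transparent, so that facts on rows give those on columns by conversion. *)
Definition transpose (n : nat) (L : lattice_path n) : lattice_path n.
Proof.
refine (@LatticePath n (path_col L) (path_row L) (path_label L) _ _ _ (@label_step n L)).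
- by have [] := path_start L.
- by have [] := path_end L.
- by move=> s /(path_step L)[[-> ->]|[-> ->]]; [right | left].
Defined.

Definition on_path (n : nat) (L : lattice_path n) (c : nat -> nat -> int) : Prop :=
  forall s, (s <= n.*2)%N -> c (path_row L s) (path_col L s) = (path_label L s)%:Z.

(* Row [r] is marked when [L] crosses it by a step that increments the label;
   columns are marked through the transposed path. *)
Definition marked (n : nat) (L : lattice_path n) (r : nat) : bool :=
  [exists s : 'I_n.*2, [&& path_row L s == r, path_row L s.+1 == r.+1 &
                           path_label L s.+1 == (path_label L s).+1]].

Definition crosses (n : nat) (L : lattice_path n) (r s : nat) : Prop :=
  [/\ (s < n.*2)%N, path_row L s = r & path_row L s.+1 = r.+1].

Definition marks (n : nat) (L : lattice_path n) (i : nat) : nat :=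
  \sum_(r < n | (r < i)%N) marked L r.

Definition path_corner (n : nat) (L : lattice_path n) (i j : nat) : nat :=
  minn (minn i j) (marks L i + marks (transpose L) j).

(* [s] ranges over the possible starts of a run of label increments. *)
Definition has_room (n : nat) (L : lattice_path n) : Prop :=
  forall s, (s <= n.*2)%N -> path_label L s = path_label L s.-1 ->
  ((path_label L s < path_row L s)%N \/ (path_col L s <= (path_label L s).+1)%N) /\
  ((path_label L s < path_col L s)%N \/ (path_row L s <= (path_label L s).+1)%N).

Section LatticePath.
Variable n : nat.
Implicit Types (L : lattice_path n) (t : 'S_n).

Lemma row_mono L s s' : (s <= s' <= n.*2)%N -> (path_row L s <= path_row L s')%N.
Proof.
case/andP; elim: s' => [|s' IH] ss' ls'; first by have -> : s = 0%N by lia.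
have [->//|ns] := eqVneq s s'.+1.
by have := IH ltac:(lia) ltac:(lia); case: (path_step L ls'); lia.
Qed.

Lemma col_mono L s s' : (s <= s' <= n.*2)%N -> (path_col L s <= path_col L s')%N.
Proof. exact: (@row_mono (transpose L)). Qed.

Lemma row_le L s : (s <= n.*2)%N -> (path_row L s <= n)%N.
Proof.
move=> ls; have [E _ _] := path_end L.
by have := @row_mono L s n.*2; rewrite E ls leqnn; apply.
Qed.

Lemma col_le L s : (s <= n.*2)%N -> (path_col L s <= n)%N.
Proof. exact: (@row_le (transpose L)). Qed.

Lemma ex_crossing L r : (r < n)%N -> exists s, crosses L r s.
Proof.
move=> lr; have [r0 _ _] := path_start L; have [rn _ _] := path_end L.
suff H s : (s <= n.*2)%N -> (r < path_row L s)%N -> exists s, crosses L r s.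
  by apply: (H n.*2) => //; rewrite rn.
elim: s => [|s IH] ls lt_r; first by rewrite r0 in lt_r.
have [lt_r'|le_r] := ltnP r (path_row L s); first exact: IH (ltnW ls) lt_r'.
by exists s; case: (path_step L ls) => -[E _]; split; lia.
Qed.

Lemma markedE L r s : crosses L r s ->
  marked L r = (path_label L s.+1 == (path_label L s).+1).
Proof.
move=> [ls rs rs1]; apply/existsP/idP => [[s' /and3P[/eqP rs' /eqP rs1' ll]]|ll].
  have ls' := ltn_ord s'.
  have [ss'|ss'|->//] := ltngtP s s'.
    by have := @row_mono L s.+1 s' ltac:(lia); lia.
  by have := @row_mono L s'.+1 s ltac:(lia); lia.
by exists (Ordinal ls); rewrite /= rs rs1 !eqxx.
Qed.

Lemma marks0 L : marks L 0 = 0%N.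
Proof. by rewrite /marks big_pred0. Qed.

Lemma marksS L i : (i < n)%N -> marks L i.+1 = (marks L i + marked L i)%N.
Proof.
move=> lin; rewrite /marks (bigD1 (Ordinal lin)) //= addnC; congr (_ + _)%N.
by apply: eq_bigl => r; rewrite ltnS ltn_neqAle andbC.
Qed.

Lemma marks_bounds L i i' : (i <= i' <= n)%N ->
  (marks L i <= marks L i' <= marks L i + (i' - i))%N.
Proof.
case/andP; elim: i' => [|i' IH] ii' li'; first by have ->: i = 0%N; lia.
have [->|ni] := eqVneq i i'.+1; first lia.
by have := IH ltac:(lia) ltac:(lia); rewrite marksS //; case: marked; lia.
Qed.

(** Each label increment marks exactly one line, the row or the column that its step crosses. *)
Lemma label_marks L s : (s <= n.*2)%N ->
  path_label L s = (marks L (path_row L s) + marks (transpose L) (path_col L s))%N.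
Proof.
elim: s => [|s IH] ls; first by have [-> -> ->] := path_start L; rewrite !marks0.
have {IH} := IH (ltnW ls); have := label_step L ls.
case: (path_step L ls) => -[er ec].
  rewrite er ec marksS -?er ?row_le // (@markedE L _ s); last by split.
  by case: eqP; lia.
rewrite er ec marksS -?ec ?col_le // (@markedE (transpose L) _ s) /=; last by split.
by case: eqP; lia.
Qed.

Lemma on_path_inv L t : on_path L (corner_sum (perm_asm t)) ->
  on_path (transpose L) (corner_sum (perm_asm t^-1%g)).
Proof. by move=> H s ls; rewrite corner_perm_inv H. Qed.

Lemma has_room_transpose L : has_room L -> has_room (transpose L).
Proof. by move=> H s ls E; have [] := H s ls E. Qed.

Section OnPath.
Variables (L : lattice_path n) (t : 'S_n).
Hypothesis tL : on_path L (corner_sum (perm_asm t)).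

(** The corner sum, which is the label on the path, rises across row [r] exactly when the dot of
    this row comes before the path. *)
Lemma marked_dot (r : 'I_n) s : crosses L r s -> marked L r = (t r < path_col L s)%N.
Proof.
move=> Hs; rewrite (markedE Hs); case: Hs => ls rs rs1.
have := tL ls; have := tL (ltnW ls); have [[_ ->]|] := path_step L ls; last lia.
by rewrite rs rs1 corner_perm_row; case: ltnP; case: eqP; lia.
Qed.

End OnPath.

(* A dot below the path has its row marked, a dot above it its column. *)
Lemma marked_col L t (r : 'I_n) : on_path L (corner_sum (perm_asm t)) ->
  marked (transpose L) (t r) = ~~ marked L r.
Proof.
move=> tL; have [s Hs] := ex_crossing L (ltn_ord r).
have [s' Hs'] := ex_crossing (transpose L) (ltn_ord (t r)).
rewrite (marked_dot tL Hs) (marked_dot (on_path_inv tL) Hs') permK /=.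
case: Hs Hs' => ls rs rs1 [ls' /= cs' cs1'].
have [[r1 c1]|] := path_step L ls; last lia.
have [[]|[r2 c2]] := path_step L ls'; first lia.
have [ss'|ss'|E] := ltngtP s s'.
- have := @row_mono L s.+1 s' ltac:(lia); have := @col_mono L s s' ltac:(lia).
  by rewrite -leqNgt cs' => -> ; lia.
- have := @row_mono L s' s ltac:(lia); have := @col_mono L s'.+1 s ltac:(lia); lia.
by rewrite -E in r2; lia.
Qed.

(** Each dot is counted once: by its row if that is marked, by its column otherwise. *)
Lemma corner_split L t i j : on_path L (corner_sum (perm_asm t)) ->
  corner_sum (perm_asm t) i j =
  (\sum_(r < n | (r < i)%N) (marked L r && (t r < j)%N) +
   \sum_(k < n | (k < j)%N) (marked (transpose L) k && ((t^-1)%g k < i)%N))%N%:Z.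
Proof.
move=> tL; rewrite corner_permE; congr Posz.
rewrite [X in (_ + X)%N]big_mkcond [X in (_ + X)%N](reindex_inj (@perm_inj _ t)) /=.
rewrite [X in (X + _)%N]big_mkcond -big_split [LHS]big_mkcond /=.
apply: eq_bigr => r _; rewrite permK marked_col //.
by case: (r < i)%N; case: (t r < j)%N; case: (marked L r).
Qed.

Lemma corner_le_path_corner L t i j : on_path L (corner_sum (perm_asm t)) ->
  (i <= n)%N -> (j <= n)%N ->
  corner_sum (perm_asm t) i j <= (path_corner L i j)%:Z.
Proof.
move=> tL li lj; have [_ ci cj _] := corner_sum_bounds (perm_asm t) li lj.
have : corner_sum (perm_asm t) i j <= (marks L i + marks (transpose L) j)%N%:Z.
  rewrite (corner_split _ _ tL) lez_nat /marks.
  by apply: leq_add; apply: leq_sum => r _; case: (marked _ _); case: (_ < _)%N.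
by rewrite /path_corner; lia.
Qed.

Section Minimum.
Variable L : lattice_path n.

Lemma path_corner_is_corner : is_corner n (fun i j => (path_corner L i j)%:Z).
Proof.
have [rn cn ln] := path_end L.
have := label_marks L (leqnn _); rewrite rn cn ln => tot.
have MS (M : lattice_path n) i : (i < n)%N ->
    marks M i.+1 = marks M i \/ marks M i.+1 = (marks M i).+1.
  by move=> li; rewrite marksS //; case: marked; lia.
rewrite /path_corner; split=> [k lk|k lk|i j li lj|i j li lj].
- by split; lia.
- have := marks_bounds L (ltac:(lia) : (k <= n <= n)%N).
  have := marks_bounds (transpose L) (ltac:(lia) : (k <= n <= n)%N); lia.
- by have := MS L i li; lia.
by have := MS (transpose L) j lj; lia.
Qed.

(** [marks] grows by 0 or 1 at each index, which keeps the mixed differences of [path_corner]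
    nonnegative. *)
Lemma path_corner_perm : exists t, forall i j, (i <= n)%N -> (j <= n)%N ->
  corner_sum (perm_asm t) i j = (path_corner L i j)%:Z.
Proof.
have [i j|t E] := @nonneg_asm_perm n (asm_of_corner path_corner_is_corner).
  rewrite mxE /path_corner.
  have := marksS L (ltn_ord i); have := marksS (transpose L) (ltn_ord j).
  by do 2!case: (marked _ _); lia.
by exists t => i j li lj; rewrite -E asm_of_cornerE.
Qed.

End Minimum.

(** On the path the sum of marks is the label. It is also a corner sum of [A], hence at most both
    coordinates, and so it is the minimum. *)
Lemma path_corner_on_path L A t : on_path L (corner_sum (A : ASM n)) ->
  (forall i j, (i <= n)%N -> (j <= n)%N ->
     corner_sum (perm_asm t) i j = (path_corner L i j)%:Z) ->
  on_path L (corner_sum (perm_asm t)).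
Proof.
move=> AL H s ls; have [lr lc] := (row_le L ls, col_le L ls).
rewrite H // /path_corner -label_marks //.
by have := AL s ls; have [] := corner_sum_bounds A lr lc; lia.
Qed.

Lemma path_corner_marked_incr L t (r r' : 'I_n) :
  on_path L (corner_sum (perm_asm t)) ->
  (forall i j, (i <= n)%N -> (j <= n)%N ->
     corner_sum (perm_asm t) i j = (path_corner L i j)%:Z) ->
  marked L r -> marked L r' -> (r < r')%N -> (t r < t r')%N.
Proof.
move=> tL H mr mr' rr'; rewrite ltnNge; apply/negP => le_t.
have lt_t : (t r' < t r)%N.
  rewrite ltn_neqAle le_t andbT; apply: contraTneq rr' => /val_inj /perm_inj ->.
  by rewrite ltnn.
(* The corner sum jumps at the dot of row [u], whose column is unmarked; comparing the minima around
   the dot determines [t u]. *)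
have E (u : 'I_n) : marked L u ->
    t u = minn u (marks L u + marks (transpose L) (t u)) :> nat.
  move=> mu; have [lu lk] := (ltn_ord u, ltn_ord (t u)).
  have := corner_perm_row t u (t u); have := corner_perm_row t u (t u).+1.
  rewrite ltnn ltnSn !H //; try exact: ltnW.
  rewrite /path_corner !marksS // marked_col // mu /=; lia.
have := E r mr; have := E r' mr'.
have := marks_bounds L (ltac:(have := ltn_ord r'; lia) : (r <= r' <= n)%N).
(* Column [t r'] is unmarked, so the number of marked columns grows by less than [t r - t r'] from
   [t r'] to [t r]. *)
have := marks_bounds (transpose L) (ltac:(have := ltn_ord (t r); lia) :
  ((t r').+1 <= t r <= n)%N).
rewrite marksS // marked_col // mr' /=; lia.
Qed.

(** The dots in marked rows increase, and by transposition so do those in marked columns; among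
    three dots, two are of the same kind. *)
Lemma path_corner_avoids_321 L t : on_path L (corner_sum (perm_asm t)) ->
  (forall i j, (i <= n)%N -> (j <= n)%N ->
     corner_sum (perm_asm t) i j = (path_corner L i j)%:Z) ->
  avoids_321 t.
Proof.
move=> tL H.
have same (r r' : 'I_n) : (r < r')%N -> (t r' < t r)%N -> marked L r = ~~ marked L r'.
  move=> rr' tt'; case mr: (marked L r); case mr': (marked L r') => //.
    by have := path_corner_marked_incr tL H mr mr' rr'; lia.
  have Hinv i j : (i <= n)%N -> (j <= n)%N ->
      corner_sum (perm_asm t^-1%g) i j = (path_corner (transpose L) i j)%:Z.
    by move=> li lj; rewrite corner_perm_inv H // /path_corner [minn j i]minnC addnC.
  have := @path_corner_marked_incr _ _ (t r') (t r) (on_path_inv tL) Hinv.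
  rewrite !marked_col // mr mr' !permK => /(_ isT isT tt'); lia.
move=> i j k ij jk [kj ji].
have := same i j ij ji; have := same j k jk kj.
have := same i k (ltn_trans ij jk) (ltn_trans kj ji).
by do 3!case: (marked _ _).
Qed.

Lemma ex_run_start L s : (s < n.*2)%N -> path_label L s.+1 = (path_label L s).+1 ->
  exists s0, [/\ (s0 <= s)%N, path_label L s0 = path_label L s0.-1 &
    forall u, (s0 <= u <= s)%N -> path_label L u.+1 = (path_label L u).+1].
Proof.
elim: s => [|s IH] ls inc.
  (* Since [0.-1 = 0], step 0 counts as the start of a run. *)
  by exists 0%N; split=> // u; rewrite leqn0 => /eqP->.
have [flat|inc'] := label_step L (ltnW ls).
  by exists s.+1; split=> // u us; have -> : u = s.+1 by lia.
have [s0 [s0s flat incs]] := IH (ltnW ls) inc'.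
exists s0; split=> //; first lia.
by move=> u; have [->//|nu] := eqVneq u s.+1 => us; apply: incs; lia.
Qed.

(* At the start of the run of increments that crosses row [r], the label is
   smaller than the number of rows above, so one of these rows has its dot to the
   right of the path: with [r] and [r'] it makes a 321 pattern. *)
Lemma avoids_321_marked L t (r r' : 'I_n) : has_room L ->
  on_path L (corner_sum (perm_asm t)) -> avoids_321 t ->
  marked L r -> (r < r')%N -> (t r' < t r)%N -> False.
Proof.
move=> room tL av mr rr' tt'; have [s Hs] := ex_crossing L (ltn_ord r).
have lt_c : (t r < path_col L s)%N by rewrite -(marked_dot tL Hs).
have inc : path_label L s.+1 = (path_label L s).+1 by apply/eqP; rewrite -(markedE Hs).
case: Hs => ls rs rs1; have [s0 [s0s flat incs]] := ex_run_start ls inc.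
have le_r0 : (path_row L s0 <= r)%N by rewrite -rs row_mono // s0s ltnW.
(* Otherwise column [t r] would be crossed within the run, hence marked, although row [r] is. *)
have lt_k : (t r < path_col L s0)%N.
  rewrite ltnNge; apply/negP => le_c.
  have [u Hu] := ex_crossing (transpose L) (ltn_ord (t r)).
  have := markedE Hu; rewrite marked_col // mr /= => /esym/eqP; apply.
  case: Hu => /= lu cu cu1; apply: incs.
  apply/andP; split; rewrite leqNgt; apply/negP => ?.
    by have := @col_mono L u.+1 s0 ltac:(lia); lia.
  by have := @col_mono L s u ltac:(lia); lia.
have ls0 : (s0 <= n.*2)%N by lia.
have lr0 := row_le L ls0; have lc0 := col_le L ls0.
pose c := corner_sum (perm_asm t^-1%g).
have step (u : 'I_n) : (path_row L s0 <= u)%N ->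
    c (t u).+1 (path_row L s0) = c (t u) (path_row L s0).
  move=> le_u; rewrite /c corner_perm_row permK.
  by rewrite ltnNge le_u addr0.
have lt_tr := ltn_ord (t r).
have b0 : c (t r') (path_row L s0) <= (t r')%:Z.
  by have [] := corner_sum_bounds (perm_asm t^-1%g) (ltnW (ltn_ord (t r'))) lr0.
have b1 := corner_sum_rows (perm_asm t^-1%g)
  (ltac:(lia) : ((t r').+1 <= t r <= n)%N) lr0.
have b2 := corner_sum_rows (perm_asm t^-1%g)
  (ltac:(lia) : ((t r).+1 <= path_col L s0 <= n)%N) lr0.
have e1 := step r' ltac:(lia); have e2 := step r le_r0.
have e0 : c (path_col L s0) (path_row L s0) = (path_label L s0)%:Z.
  by rewrite /c corner_perm_inv tL.
(* Columns [t r'] and [t r] have their dots outside the first [path_row L s0] rows. So the label is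
   at most [path_col L s0 - 2], and [has_room] leaves only this case. *)
have lt_lab : (path_label L s0 < path_row L s0)%N.
  by have [[//|le] _] := room s0 ls0 flat; rewrite /c in b0 e0 e1 e2; lia.
have [r0 r0r c0] := @corner_perm_lt_row n t (path_row L s0) (path_col L s0) lr0
  ltac:(rewrite tL //; lia).
by apply: (av r0 r r'); [lia | lia | split; lia].
Qed.

(** A corner sum below [minn i j] leaves a dot beyond each side of the corner. By
    [avoids_321_marked] these two dots force the dots of marked rows before [i] and marked columns
    before [j] inside, so the sum of marks is reached. *)
Lemma avoids_321_path_corner L t i j : has_room L ->
  on_path L (corner_sum (perm_asm t)) -> avoids_321 t ->
  (i <= n)%N -> (j <= n)%N ->
  (path_corner L i j)%:Z <= corner_sum (perm_asm t) i j.
Proof.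
move=> room tL av li lj; rewrite leNgt; apply/negP; rewrite /path_corner => lt_c.
have [r1 r1i jr1] := @corner_perm_lt_row n t i j li ltac:(lia).
have [r2 ir2 r2j] := @corner_perm_lt_col n t i j lj ltac:(lia).
have none_row (r : 'I_n) : (r < i)%N -> marked L r -> (t r < j)%N.
  move=> ri mr; rewrite ltnNge; apply/negP => jr.
  by apply: (avoids_321_marked room tL av mr (r' := r2)); lia.
have none_col (k : 'I_n) : (k < j)%N -> marked (transpose L) k -> ((t^-1)%g k < i)%N.
  move=> kj mk; rewrite ltnNge; apply/negP => ik.
  apply: (avoids_321_marked (has_room_transpose room) (on_path_inv tL)
    (avoids_321_inv av) mk (r' := t r1)); rewrite ?permK; lia.
move: lt_c; rewrite (corner_split _ _ tL) ltz_nat ltnNge => /negP; apply.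
apply: leq_trans (geq_minr _ _) _; apply: leq_add; apply: leq_sum => r lt_r.
  by case mr: (marked L r); rewrite //= none_row.
by case mr: (marked _ r); rewrite //= none_col.
Qed.

End LatticePath.

(** * The lattice path of a congruence class *)

Section BoundaryPath.
Variables (n : nat) (F : ASM n -> dyck n) (x : nat -> nat -> nat).
Hypothesis n_gt0 : (0 < n)%N.
Hypothesis x_coherent : coherent n x.
Hypothesis F_boxes : box_positions F x.

(* Extends [x] to the empty boxes, with [b = a.-1], which every Dyck path
   contains, and to the boxes with [b = n], which none contains. *)
Definition extended_position (a b : nat) : nat :=
  if (b < n)%N then if (b < a)%N then a.-1 else x a b
  else if (n.-1 < a)%N then a else (x a n.-1).+1.

Lemma extended_position_bounds a b : (0 < a <= n)%N -> (a <= b.+1)%N -> (b <= n)%N ->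
  (a.-1 <= extended_position a b <= b)%N /\ (a + b <= n + extended_position a b)%N.
Proof.
move=> an ab bn; rewrite /extended_position.
case: ltnP => ltb; case: ltnP => lta; try by lia.
  by have [] := x_coherent (ltac:(lia) : (0 < a <= b)%N) ltb; lia.
by have [] := x_coherent (ltac:(lia) : (0 < a <= n.-1)%N) ltac:(lia); lia.
Qed.

Lemma extended_position_right a b : (0 < a <= n)%N -> (a <= b.+1)%N -> (b < n)%N ->
  (extended_position a b <= extended_position a b.+1 <= (extended_position a b).+1)%N.
Proof.
move=> an ab bn; rewrite /extended_position bn.
have [ltb|leb] := ltnP b.+1 n.
  case: ltnP => lta; case: ltnP => lta'; try by lia.
    have -> : b.+1 = a by lia.
    by have [] := x_coherent (ltac:(lia) : (0 < a <= a)%N) ltac:(lia); lia.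
  by have [_ /(_ ltb)] := x_coherent (ltac:(lia) : (0 < a <= b)%N) bn.
have -> : n.-1 = b by lia.
by case: ltnP; lia.
Qed.

Lemma extended_position_left a b : (0 < a <= b)%N -> (b <= n)%N -> (a < n)%N ->
  (extended_position a b <= extended_position a.+1 b <= (extended_position a b).+1)%N.
Proof.
move=> ab bn an; rewrite /extended_position.
case: (ltnP b n) => ltb.
  case: (ltnP b a) => lta; first lia.
  have [xa _ xl] := x_coherent ab ltb.
  by case: (ltnP b a.+1) => lta'; [lia | apply: xl].
case: (ltnP n.-1 a) => lta; first lia.
have [xa _ xl] := x_coherent (ltac:(lia) : (0 < a <= n.-1)%N) ltac:(lia).
by case: (ltnP n.-1 a.+1) => lta'; [lia | rewrite !ltnS; apply: xl].
Qed.

Lemma extended_box a b A : (0 < a <= n)%N -> (a <= b.+1)%N -> (b <= n)%N ->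
  has_box (F A) a b = (corner_sum A (extended_position a b)
                         (a + b - extended_position a b) <= a.-1%:Z).
Proof.
move=> an ab bn; have [pos pos'] := extended_position_bounds an ab bn.
have [_ c_row c_col c_ge] := @corner_sum_bounds n A (extended_position a b)
  (a + b - extended_position a b) ltac:(lia) ltac:(lia).
have [d1 d2 d3] := @downs_bounds n (F A) (a + b) ltac:(lia).
have hE := @height_downs n (F A) (a + b) ltac:(lia).
(* For [b = n] both sides are false and for [b = a.-1] both are true, by the bounds on down steps
   and corner sums. *)
have [bn'|bn'] := ltnP b n; last first.
  rewrite /has_box; lia.
have [ba|ba] := ltnP b a; last first.
  rewrite /extended_position bn' ltnNge ba F_boxes //; lia.
have posE : extended_position a b = a.-1 by rewrite /extended_position bn' ba.
rewrite posE in c_row *; rewrite /has_box; lia.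
Qed.

Variable P : dyck n.

Definition boundary_row (s : nat) : nat :=
  if s is r.+1 then extended_position (downs P r).+1 (r - downs P r) else 0.

Lemma boundary_row_bounds s : (s < n.*2)%N ->
  (downs P s <= boundary_row s.+1 <= s - downs P s)%N.
Proof.
move=> ls; have [d1 d2 d3] := downs_bounds P (ltnW ls).
by have [] := @extended_position_bounds (downs P s).+1 (s - downs P s)%N
  ltac:(lia) ltac:(lia) ltac:(lia).
Qed.

Fact boundary_start : [/\ boundary_row 0 = 0, 0 - boundary_row 0 = 0 & downs P 0 = 0]%N.
Proof. by rewrite downs0. Qed.

Fact boundary_end : [/\ boundary_row n.*2 = n, (n.*2 - boundary_row n.*2)%N = n &
  downs P n.*2 = n].
Proof.
suff E : boundary_row n.*2 = n by rewrite E downs_top; split=> //; lia.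
have nE : n.*2 = n.*2.-1.+1 by lia.
have [d1 d2 d3] := @downs_bounds n P n.*2.-1 ltac:(lia).
have := downsS P (ltac:(lia) : (n.*2.-1 < n.*2)%N); rewrite -nE downs_top => dn.
rewrite nE /=; have -> : (downs P n.*2.-1).+1 = n by lia.
have -> : (n.*2.-1 - downs P n.*2.-1)%N = n by lia.
by rewrite /extended_position ltnn ltn_predL n_gt0.
Qed.

(** An up step of [P] increases [b] and a down step increases [a]; coherence then allows one step in
    a row or in a column. *)
Fact boundary_step s : (s < n.*2)%N ->
  boundary_row s.+1 = (boundary_row s).+1 /\
    (s.+1 - boundary_row s.+1 = s - boundary_row s)%N \/
  boundary_row s.+1 = boundary_row s /\
    (s.+1 - boundary_row s.+1 = (s - boundary_row s).+1)%N.
Proof.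
case: s => [_|s ls].
  by rewrite /= downs0 /extended_position n_gt0; right.
have := boundary_row_bounds (ltnW ls); have := boundary_row_bounds ls.
have [d1 d2 d3] := downs_bounds P (ltnW ls).
have [e1 e2 e3] := @downs_bounds n P s ltac:(lia).
have [f1 f2 f3] := downs_bounds P ls.
rewrite /=; case: (downsS P (ltnW ls)) => E; rewrite E in d1 d2 d3 *.
  have -> : (s.+1 - downs P s = (s - downs P s).+1)%N by lia.
  have := @extended_position_right (downs P s).+1 (s - downs P s)%N
    ltac:(lia) ltac:(lia) ltac:(lia).
  lia.
have -> : (s.+1 - (downs P s).+1 = s - downs P s)%N by lia.
have := @extended_position_left (downs P s).+1 (s - downs P s)%N
  ltac:(lia) ltac:(lia) ltac:(lia).
lia.
Qed.

(* After [s] steps of [P], with [d] of them down, the path is at the position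
   of the box [(d.+1, s - d)], which lies under [P] iff the next step is up. *)
Definition boundary_path : lattice_path n :=
  @LatticePath n boundary_row (fun s => s - boundary_row s)%N (downs P)
    boundary_start boundary_end boundary_step (@downsS n P).

(** For a box with [a <= b], the bounds [a <= x a b <= b] put both coordinates above the label
    [a.-1]; an empty box is at [(d, d.+1)], with label [d]. *)
Lemma boundary_has_room : has_room boundary_path.
Proof.
case=> [_ _|s ls /= flat]; first by split; right.
have [d1 d2 d3] := downs_bounds P ls; rewrite flat in d1 d2 d3 *.
have [e1 e2 e3] := downs_bounds P (ltnW ls).
have := boundary_row_bounds ls => /=.
have [lt_d|le_d] := ltnP (downs P s) (s - downs P s)%N; last lia.
have -> : extended_position (downs P s).+1 (s - downs P s) =
    x (downs P s).+1 (s - downs P s).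
  rewrite /extended_position; have -> : (s - downs P s < n)%N by lia.
  by case: ltnP => //; lia.
have [? _ _] := x_coherent
  (ltac:(lia) : (0 < (downs P s).+1 <= s - downs P s)%N) ltac:(lia).
lia.
Qed.

Lemma boundary_corner_step (A : ASM n) s : (s < n.*2)%N ->
  let c r := corner_sum A (path_row boundary_path r) (path_col boundary_path r) in
  c s.+1 = c s \/ c s.+1 = c s + 1.
Proof.
move=> ls; have [_ _ rstep cstep] := corner_sum_is_corner A.
have lr := row_le boundary_path ls; have lc := col_le boundary_path ls.
have lr' := row_le boundary_path (ltnW ls).
have lc' := col_le boundary_path (ltnW ls).
case: (path_step boundary_path ls) => -[Er Ec] c; rewrite /c Er Ec.
  by apply: rstep; rewrite -?Er.
by apply: cstep; rewrite -?Ec.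
Qed.

Lemma boundary_box (A : ASM n) s : (s < n.*2)%N ->
  ((s - downs P s)%N%:Z + 2 <= (downs P s).+1%:Z + height (F A) s.+1) =
  (corner_sum A (path_row boundary_path s.+1) (path_col boundary_path s.+1)
     <= (downs P s)%:Z).
Proof.
move=> ls; have [d1 d2 d3] := downs_bounds P (ltnW ls).
have := @extended_box (downs P s).+1 (s - downs P s)%N A ltac:(lia) ltac:(lia) ltac:(lia).
by rewrite /has_box /=; have -> : ((downs P s).+1 + (s - downs P s) = s.+1)%N by lia.
Qed.

(** Once the values at [s] agree with [P], [boundary_box] ties the next step of [F A] to the next
    corner sum: the step is down iff the corner sum rises. *)
Lemma boundary_pathP (A : ASM n) : F A = P <-> on_path boundary_path (corner_sum A).
Proof.
split=> [FA|HA].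
  elim=> [|s IH] ls; first by rewrite /= corner_sum0l downs0.
  have /= := boundary_corner_step A ls; have := boundary_box A ls.
  have [d1 d2 d3] := downs_bounds P (ltnW ls).
  rewrite (IH (ltnW ls)) FA (height_downs P ls) /=.
  by have := downsS P ls; lia.
apply: height_inj; elim=> [|s IH] ls; first by rewrite !height0.
have := boundary_box A ls; rewrite (HA s.+1 ls) /=.
have := height_downs P ls; have := height_downs P (ltnW ls).
have := downsS P ls; have := IH (ltnW ls).
have [d1 d2 d3] := downs_bounds P (ltnW ls).
have [_ _ _ step] := height_is_dyck_height (F A).
by have := step s ls; lia.
Qed.

End BoundaryPath.

Lemma catalan_class_path (n : nat) (e : lattice_congruence (ASM n))
    (C : lattice_quotient e) : (0 < n)%N -> catalan_congruence e ->
  exists2 L : lattice_path n, has_room L &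
    forall A, (\pi_(lattice_quotient e) A)%qT = C <-> on_path L (corner_sum A).
Proof.
move=> n_gt0 [f [f_bij fI fU]]; pose F (A : ASM n) := f (\pi_(lattice_quotient e) A)%qT.
have FI : {morph F : A B / (A `&` B)%O}.
  by move=> A B; rewrite /F -fI; congr f; rewrite -quotient_meetE.
have FU : {morph F : A B / (A `|` B)%O}.
  by move=> A B; rewrite /F -fU; congr f; rewrite -quotient_joinE.
have [g fK gK] := f_bij.
have F_surj P : exists A, F A = P by exists (repr (g P)); rewrite /F reprK gK.
have [x [x_coherent boxes]] := ex_box_positions FI FU F_surj.
(* [h] is [f], or [f] followed by the reversal of Dyck paths. *)
have path_of (h : lattice_quotient e -> dyck n) : injective h ->
    box_positions (fun A => h (\pi_(lattice_quotient e) A)%qT) x ->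
    exists2 L : lattice_path n, has_room L &
    forall A, (\pi_(lattice_quotient e) A)%qT = C <-> on_path L (corner_sum A).
  move=> h_inj h_boxes; exists (boundary_path n_gt0 x_coherent (h C)) => [|A].
    exact: boundary_has_room.
  by rewrite -(boundary_pathP n_gt0 x_coherent h_boxes (h C)); split=> [->|/h_inj].
case: boxes => boxes; first exact: path_of (bij_inj f_bij) boxes.
exact: path_of (inj_comp (can_inj (@dyck_revK n)) (bij_inj f_bij)) boxes.
Qed.

(** * Least permutations of the congruence classes *)

Theorem theorem6p10 (n : nat) (n_ge1 : (1 <= n)%N)
    (e : lattice_congruence (ASM n)) (e_catalan : catalan_congruence e) :
  (forall C : lattice_quotient e, exists! s : 'S_n, minimal_perm C s) /\
  (forall s : 'S_n,
     (exists C : lattice_quotient e, minimal_perm C s) <-> avoids_321 s).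
Proof.
have le_min (C : lattice_quotient e) (L : lattice_path n) (s t : 'S_n) :
    (forall A, (\pi_(lattice_quotient e) A)%qT = C <-> on_path L (corner_sum A)) ->
    (forall i j, (i <= n)%N -> (j <= n)%N ->
       (path_corner L i j)%:Z <= corner_sum (perm_asm s) i j) ->
    in_class C t -> (perm_asm s <= perm_asm t)%O.
  move=> LC s_min /LC tL; apply/asm_leP => i j li lj.
  exact: le_trans (corner_le_path_corner tL li lj) (s_min i j li lj).
(* Each class even has a least permutation, the one with corner sums [path_corner]. *)
have least (C : lattice_quotient e) : exists s : 'S_n, [/\ in_class C s, avoids_321 s &
    forall t, in_class C t -> (perm_asm s <= perm_asm t)%O].
  have [L room LC] := catalan_class_path C n_ge1 e_catalan.
  have [s sE] := path_corner_perm L.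
  have AL : on_path L (corner_sum (repr C)) by apply/LC; rewrite reprK.
  have sL := path_corner_on_path AL sE.
  exists s; split; [exact/LC | exact: path_corner_avoids_321 sL sE | move=> t].
  by apply: (le_min C L s t LC) => i j li lj; rewrite sE.
have min_least (C : lattice_quotient e) s t : minimal_perm C t -> in_class C s ->
    (forall t, in_class C t -> (perm_asm s <= perm_asm t)%O) -> s = t.
  by move=> [tC t_min] sC s_le; apply: t_min => //; apply: s_le.
have least_min (C : lattice_quotient e) s : in_class C s ->
    (forall t, in_class C t -> (perm_asm s <= perm_asm t)%O) -> minimal_perm C s.
  move=> sC s_le; split=> // t tC ts; apply: perm_asm_inj; apply/le_anti.
  by rewrite ts s_le.
split=> [C|s].
  have [s [sC _ s_le]] := least C; exists s; split=> [|t t_min]; first exact: least_min.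
  exact: min_least t_min sC s_le.
split=> [[C s_min]|s_av].
  have [t [tC t_av t_le]] := least C.
  by rewrite -(min_least C t s s_min tC t_le).
(* The corner sums of a 321-avoiding [s] reach the upper bound of its own class, which makes it
   least there. *)
pose C := (\pi_(lattice_quotient e) (perm_asm s))%qT; exists C.
have [L room LC] := catalan_class_path C n_ge1 e_catalan.
apply: least_min => // t; apply: (le_min C L s t LC) => i j li lj.
by apply: avoids_321_path_corner => //; apply/LC.
Qed.
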